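(* Let $n\ge 2$ and $0\le j\le n$, and let $\mathcal{T}_n$ be the arrangement of hyperplanes $\{x_i+x_j=0\mid 1\le i<j\le n\}$ in $\mathbb{R}^n$. The absolute value of the coefficient of $t^j$ in the characteristic polynomial $\chi_{\mathcal{T}_n}(t)$ equals the number of labeled threshold graphs on vertex set $[n]$ with exactly $j$ odd anchors.
   Context: For a hyperplane arrangement $\mathcal{A}$ in $\mathbb{R}^n$, $\chi_{\mathcal{A}}(t)=\sum_{x\in L(\mathcal{A})}\mu(\hat 0,x)\,t^{\dim x}$, where $L(\mathcal{A})$ is the poset of nonempty intersections of hyperplanes ordered by reverse inclusion, $\hat 0=\mathbb{R}^n$, and $\mu$ its Möbius function. A signed permutation of $[n]$ is a permutation $\pi_1\cdots\pi_n$ of $[n]$ with a sign $w_i\in\{+,-\}$ assigned to each $\pi_i$. The construction associated to a signed permutation builds a graph on $[n]$ from the empty graph by adding $\pi_1,\dots,\pi_n$ in order, $\pi_i$ being added as a dominant vertex (adjacent to all previously added vertices) if $w_i=+$ and as a recessive vertex (adjacent to none of them) if $w_i=-$. Labeled threshold graphs on $[n]$ are the graphs so obtained; a construction of $G$ is a signed permutation whose construction yields $G$. A threshold pair in standard form is a signed permutation with $w_1=w_2$ and such that $w_i=w_{i+1}$ implies $\pi_i<\pi_{i+1}$; each labeled threshold graph $G$ has exactly one construction of this form, and the blocks of $G$ are the maximal runs of consecutive entries of equal sign in it, ordered left to right. A construction of $G$ follows the convention about vertex $1$ if, whenever $1$ lies in the first block of $G$, the construction adds $1$ first with sign $+$ (dominant).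 In a construction, an anchor is a vertex whose label is smaller than the labels of all vertices added after it (the first anchor is always $1$). An odd anchor is an anchor that is either the first anchor $1$ and dominant, or an anchor whose type (dominant/recessive) differs from that of the previous anchor. The number of odd anchors of $G$ is the number of odd anchors in any construction of $G$ following the convention about vertex $1$ (this number does not depend on the chosen construction). *)

(* Defs.v *)
From HB Require Import structures.
From mathcomp Require Import all_boot all_order all_algebra all_fingroup finmap.
From mathcomp Require Import reals.

Set Implicit Arguments.
Unset Strict Implicit.
Unset Printing Implicit Defensive.

Import Order.TTheory GRing.Theory Num.Theory.

Local Open Scope fset_scope.
Local Open Scope ring_scope.

Section Mobius.
Variables (T : choiceType) (le : rel T) (L : {fset T}).

(* The recursion descends strictly below y in L, so a depth of #|L| suffices:
   see mobius_xx and mobius_lt for the defining equations. *)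
Fixpoint mobius_rec (k : nat) (x y : T) : int :=
  if x == y then 1 else
  if k is k'.+1 then
    - \sum_(z <- L | [&& le x z, le z y & z != y]) mobius_rec k' x z
  else 0.

Definition mobius (x y : T) : int :=
  if le x y then mobius_rec #|` L| x y else 0.

Lemma mobius_xx (x : T) : reflexive le -> mobius x x = 1.
Proof. by move=> lexx; rewrite /mobius lexx; case: #|` L| => /=; rewrite eqxx. Qed.

Let below (x y : T) := [pred z | [&& le x z, le z y & z != y]].

Lemma mobius_rec_stable (x : T) : reflexive le -> antisymmetric le ->
  transitive le -> x \in L ->
  forall k k' y, le x y -> (count (below x y) L <= k)%N ->
    (count (below x y) L <= k')%N -> mobius_rec k x y = mobius_rec k' x y.
Proof.
move=> lexx leA leT xL.
have pos y : le x y -> x != y -> (0 < count (below x y) L)%N.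
  move=> xy nxy; rewrite -has_count; apply/hasP; exists x => //=.
  by rewrite lexx xy nxy.
elim=> [|k IH] [|k'] y xy /=; case: eqVneq => // nxy.
- by rewrite leqn0 => /eqP c0; move: (pos _ xy nxy); rewrite c0.
- by move=> _; rewrite leqn0 => /eqP c0; move: (pos _ xy nxy); rewrite c0.
move=> ck ck'; congr (- _); rewrite big_seq_cond [RHS]big_seq_cond.
apply: eq_bigr => z /and4P[zL xz zy nzy].
have lt : (count (below x z) L < count (below x y) L)%N.
  have -> : count (below x y) L
    = (count (predI (below x y) (pred1 z)) L
       + count (predI (below x y) (predC (pred1 z))) L)%N.
    rewrite -!size_filter -(count_predC (pred1 z) [seq t <- L | below x y t]).
    rewrite !count_filter !size_filter.
    by congr (_ + _)%N; apply: eq_count => t /=; rewrite andbC.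
  rewrite -add1n leq_add //.
    by rewrite -has_count; apply/hasP; exists z => //=; rewrite xz zy nzy eqxx.
  apply: sub_count => t /= /and3P[xt tz ntz].
  rewrite xt (leT _ _ _ tz zy) ntz andbT /=.
  apply/eqP => ty; subst t; move/eqP: nzy; apply.
  by apply: leA; rewrite zy tz.
by apply: IH => //; rewrite -ltnS; apply: leq_trans lt _.
Qed.

Lemma mobius_lt (x y : T) : reflexive le -> antisymmetric le -> transitive le ->
  x \in L -> y \in L -> le x y -> x != y ->
  mobius x y = - \sum_(z <- L | [&& le x z, le z y & z != y]) mobius x z.
Proof.
move=> lexx leA leT xL yL xy nxy.
have cL w : (count (below x w) L <= #|` L|)%N by exact: count_size.
rewrite {1}/mobius xy.
rewrite (@mobius_rec_stable x lexx leA leT xL _ #|` L|.+1 y xy) //; last first.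
  exact: leqW.
rewrite /= (negbTE nxy); congr (- _); apply: eq_bigr => z /and3P[xz _ _].
by rewrite /mobius xz.
Qed.

End Mobius.

Section CentralArrangement.
Variables (F : fieldType) (V : vectType F) (A : {fset {vspace V}}).

(* All members of A are linear, so every intersection contains 0 and the
   nonemptiness requirement on flats is automatic.  The empty subfamily
   contributes the whole space. *)
Definition flats : {fset {vspace V}} :=
  [fset (\bigcap_(H <- B) H)%VS | B : {fset {vspace V}} in fpowerset A].

Definition rev_incl : rel {vspace V} := fun X Y => (Y <= X)%VS.

Definition arr_char_poly : {poly int} :=
  \sum_(X <- flats) mobius rev_incl flats fullv X *: 'X^(\dim X).

End CentralArrangement.

Section ThresholdArrangement.
Variables (R : realType) (n : nat).

Definition coord_sum (i j : 'I_n) (x : 'rV[R]_n) : R^o := x ord0 i + x ord0 j.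

Fact coord_sum_is_linear (i j : 'I_n) : linear (coord_sum i j).
Proof.
by move=> a u v; rewrite /coord_sum !mxE scalerDr addrACA.
Qed.

HB.instance Definition _ (i j : 'I_n) :=
  GRing.isLinear.Build R 'rV[R]_n R^o _ (coord_sum i j)
    (coord_sum_is_linear i j).

Definition threshold_hyperplane (i j : 'I_n) : {vspace 'rV[R]_n} :=
  lker (linfun (coord_sum i j)).

Lemma mem_threshold_hyperplane (i j : 'I_n) (x : 'rV[R]_n) :
  (x \in threshold_hyperplane i j) = (x ord0 i + x ord0 j == 0).
Proof. by rewrite memv_ker lfunE. Qed.

Definition threshold_arrangement : {fset {vspace 'rV[R]_n}} :=
  [fset threshold_hyperplane p.1 p.2 | p : 'I_n * 'I_n & (p.1 < p.2)%N].

End ThresholdArrangement.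

Section ThresholdGraphs.
Variable n : nat.

(* Labels and positions are counted from 0: the vertex 1 of [n] is the element
   of 'I_n with value 0. *)

(* A graph on [n] is given by its set of edges. *)
Definition graph := {set {set 'I_n}}.

(* (pi, w): pi i is the vertex added at step i, and w i = true means that it is
   added with sign +. *)
Definition signed_perm := ('S_n * {ffun 'I_n -> bool})%type.

Definition graph_of (c : signed_perm) : graph :=
  [set [set c.1 ik.1; c.1 ik.2] |
    ik : 'I_n * 'I_n & (ik.1 < ik.2)%N && c.2 ik.2].

Definition is_threshold (G : graph) : bool := [exists c, graph_of c == G].

Definition standard_form (c : signed_perm) : bool :=
  [forall i : 'I_n, forall k : 'I_n,
     ((i == 0%N :> nat) && (k == 1%N :> nat)) ==> (c.2 i == c.2 k)]
  && [forall i : 'I_n, forall k : 'I_n,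
     ((k == i.+1 :> nat) && (c.2 i == c.2 k)) ==> (c.1 i < c.1 k)%N].

Definition in_first_block (G : graph) (v : 'I_n) : bool :=
  [exists c, [&& standard_form c, graph_of c == G
    & [exists i, (c.1 i == v)
         && [forall k : 'I_n, (k <= i)%N ==> (c.2 k == c.2 i)]]]].

Definition follows_convention (c : signed_perm) : bool :=
  [forall v : 'I_n, ((v == 0%N :> nat) && in_first_block (graph_of c) v) ==>
     [exists i : 'I_n, [&& i == 0%N :> nat, c.1 i == v & c.2 i]]].

(* Anchors are identified with the steps at which they are added. *)
Definition anchor (c : signed_perm) (i : 'I_n) : bool :=
  [forall k : 'I_n, (i < k)%N ==> (c.1 i < c.1 k)%N].

Definition previous_anchor (c : signed_perm) (p i : 'I_n) : bool :=
  [&& anchor c p, (p < i)%N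
    & [forall k : 'I_n, (p < k < i)%N ==> ~~ anchor c k]].

Definition odd_anchor (c : signed_perm) (i : 'I_n) : bool :=
  anchor c i
  && (((c.1 i == 0%N :> nat) && c.2 i)
      || [exists p, previous_anchor c p i && (c.2 p != c.2 i)]).

(* The count does not depend on the construction picked; one exists for every
   threshold graph, so the default 0 only affects other graphs. *)
Definition odd_anchors (G : graph) : nat :=
  if [pick c | (graph_of c == G) && follows_convention c] is Some c
  then #|[set i | odd_anchor c i]| else 0%N.

End ThresholdGraphs.

(* Main.v *)
Require Import Defs.
From mathcomp Require Import all_boot all_order all_algebra all_fingroup finmap.
From mathcomp Require Import reals.
From mathcomp Require Import zify ring lra.

Set Implicit Arguments.
Unset Strict Implicit.
Unset Printing Implicit Defensive.

Import Order.TTheory GRing.Theory Num.Theory.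

(** Every flat [X] of the arrangement is cut out by equations [x_i = 0] and
    [x_i = +- x_j], so it contains exactly [(2m+1)^(dim X)] points of the box
    [{-m..m}^n].  By Moebius inversion [chi(2m+1)] is the number of box points
    on no hyperplane, whose exponential generating function in [n] is
    [(1 + x) (2 e^x - 1)^m].

    A threshold graph has a unique standard construction, a word of signed
    labels in which labels increase along equal signs and the first two signs
    agree.  Dropping the last condition gives canonical words; counting them by
    number [j] of sign changes along anchors, with weight [t^j], yields
    polynomials [y_n(t)], and the graphs contribute [y_n - n y_(n-1)].
    Splitting off the first letter gives a recurrence which shows that
    [(-1)^n y_n(-(2m+1))] is the coefficient of [x^n/n!] in [(2 e^x - 1)^m].
    Hence [chi(t)] and [(-1)^n (y_n - n y_(n-1))(-t)] agree at all odd [t]. *)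

(** * Reciprocity between words and colorings *)

Section Pascal.
Local Open Scope ring_scope.
Implicit Types (z w : nat -> int) (n r : nat).

(** For [r <= n] this is the sum over [i] of ['C(r, i) * z (n - i)], and the truncation in [n.-1] is
    never reached. The case [r = n] is the binomial transform, a factor [e^x] on exponential
    generating functions. *)
Fixpoint pascal z n r : int :=
  if r is r'.+1 then pascal z n r' + pascal z n.-1 r' else z n.

Lemma pascal_lin a b z w n r :
  pascal (fun j => a * z j + b * w j) n r = a * pascal z n r + b * pascal w n r.
Proof. by elim: r n => [|r IH] n //=; rewrite !IH; ring. Qed.

Lemma pascalDZ b z w n r :
  pascal (fun j => z j + b * w j) n r = pascal z n r + b * pascal w n r.
Proof. by elim: r n => [|r IH] n //=; rewrite !IH; ring. Qed.

Lemma pascalS z n r : (r <= n)%N ->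
  pascal z n.+1 r = pascal (fun j => z j.+1) n r.
Proof.
elim: r n => [|r IH] n //= rn; rewrite IH; last by lia.
by case: n rn => // n rn; rewrite IH.
Qed.

(** The term [z n] enters with coefficient 1 and all others have smaller index. This isolates the
    unknown in recurrences whose top term stands on both sides. *)
Lemma eq_pascal_below z w n r : (r <= n)%N ->
  (forall j, (j < n)%N -> z j = w j) ->
  pascal z n r - pascal w n r = z n - w n.
Proof.
elim: r n => [|r IH] n //= rn eqzw.
have -> : pascal z n.-1 r = pascal w n.-1 r.
  apply/eqP; rewrite -subr_eq0 IH; [|by lia|by move=> j jn; apply: eqzw; lia].
  by rewrite eqzw ?subrr; lia.
by rewrite opprD addrACA subrr addr0 IH //; lia.
Qed.

End Pascal.

(** * Colorings with pairs of opposite colors *)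

Section Colorings.
Local Open Scope ring_scope.

(* Number of maps from an [n]-set to [k] colors and [l] pairs of opposite
   colors that never use both colors of a pair; its exponential generating
   function is [e^(k x) (2 e^x - 1)^l]. *)
Fixpoint colorings n k l : int :=
  if n is n'.+1 then
    k%:Z * colorings n' k l + (2 * l)%:Z * colorings n' k.+1 l.-1
  else 1.

(** Inclusion-exclusion on one pair: a coloring misses one color or the other, and those missing
    both are counted twice. *)
Lemma colorings_pair n k l :
  colorings n k l.+1 = 2 * colorings n k.+1 l - colorings n k l.
Proof.
elim: n k l => [|n IH] k l //=; rewrite IH.
by case: l => [|l] /=; rewrite ?IH; lia.
Qed.

(** Sum over the set of elements that do not receive the additional free color. *)
Lemma pascal_colorings n k l :
  pascal (fun j => colorings j k l) n n = colorings n k.+1 l.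
Proof.
elim: n k l => [|n IH] k l //=.
rewrite pascalS // IH /= pascal_lin !IH.
lia.
Qed.

(** With [f = (2 e^x - 1)^m] this is the differential equation [f' = 2 e^x f' - 2 m e^x f], read
    coefficientwise. *)
Lemma colorings_rec n m :
  colorings n.+1 0 m =
  2 * pascal (fun j => colorings j.+1 0 m) n n
  - (2 * m)%:Z * pascal (fun j => colorings j 0 m) n n.
Proof.
rewrite /= pascal_lin !pascal_colorings mul0r add0r mul0r add0r.
case: m => [|m] /=; first by rewrite !mul0r mulr0 subr0.
by rewrite colorings_pair; ring.
Qed.

End Colorings.

(** * Recurrence for words by their first letter *)

Section FirstLetter.
Local Open Scope ring_scope.
Variable t : int.

(* Weighted number of canonical words on [n] labels after a letter that [r] of
   them precede; [b] tells whether this letter has the sign of the last anchor.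
   The sum runs over the rank [k] of the first label and over its sign. *)
Fixpoint word_sum n r b : int :=
  if n is n'.+1 then
    let step k c := if k == 0%N then (if c then 1 else t) * word_sum n' 0 true
                    else word_sum n' k c in
    \sum_(0 <= k < n'.+1) (step k (~~ b) + (r <= k)%N%:R * step k b)
  else 1.

Arguments word_sum : simpl never.

(** A first letter of rank 0 is below all later ones, hence an anchor, and costs [t] when the sign
    changes. A letter of positive rank leaves the last anchor in place. *)
Definition word_step n k c : int :=
  if k == 0%N then (if c then 1 else t) * word_sum n 0 true
  else word_sum n k c.

Lemma word_sumS n r b : word_sum n.+1 r b =
  \sum_(0 <= k < n.+1) (word_step n k (~~ b) + (r <= k)%N%:R * word_step n k b).
Proof. by []. Qed.

Lemma word_sum0 n b : word_sum n 0 b = word_sum n 0 true.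
Proof.
case: n => [//|n]; rewrite !word_sumS; apply: eq_bigr => k _ /=.
by case: b; rewrite !mul1r //= addrC.
Qed.

(** The bound [n.+1] exceeds every rank and forces a sign change at the first letter. The two values
    of [b] force the two signs, so together they cover all unconstrained words. *)
Lemma word_sum_top n :
  word_sum n.+1 n.+1 true + word_sum n.+1 n.+1 false = word_sum n.+1 0 true.
Proof.
rewrite !word_sumS -big_split /=; apply: eq_big_nat => k /andP[_ kn].
have -> : (n < k)%N = false by lia.
by rewrite !mul0r mul1r !addr0.
Qed.

(** Raising the bound by one excludes exactly the first letter of rank [r] that repeats the
    preceding sign. *)
Lemma word_sum_next n r b : (r <= n)%N ->
  word_sum n.+1 r.+1 b = word_sum n.+1 r b - word_step n r b.
Proof.
move=> rn; rewrite !word_sumS; apply/eqP; rewrite eq_sym subr_eq addrC.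
apply/eqP; rewrite !big_split /=.
rewrite addrCA; congr (_ + _).
rewrite (bigD1_seq r) ?mem_index_iota ?iota_uniq //=.
rewrite leqnn mul1r; congr (_ + _).
rewrite [RHS](bigD1_seq r) ?mem_index_iota ?iota_uniq //=.
rewrite ltnn mul0r add0r; apply: eq_bigr => k kr.
by congr (_%:R * _); lia.
Qed.

(** The alternating sign turns the difference in [word_sum_next] into the sum of Pascal's rule. *)
Lemma word_sum_pascal n r b : (r <= n)%N ->
  (-1) ^+ n.+1 * word_sum n.+1 r.+1 b =
  pascal (fun j => (-1) ^+ j.+1 * word_sum j.+1 0 true
     + (if b then 1 else t) * ((-1) ^+ j * word_sum j 0 true)) n r.
Proof.
elim: r n => [|r IH] n rn.
  rewrite word_sum_next //= (word_sum0 n.+1 b) /word_step eqxx.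
  rewrite exprS; ring.
case: n rn => // n rn.
rewrite word_sum_next // mulrBr IH /=; last by lia.
congr (_ + _).
by rewrite -IH /word_step //= exprS; ring.
Qed.

Lemma word_sum_rec n :
  (-1) ^+ n.+1 * word_sum n.+1 0 true =
  2 * pascal (fun j => (-1) ^+ j.+1 * word_sum j.+1 0 true) n n
  + (1 + t) * pascal (fun j => (-1) ^+ j * word_sum j 0 true) n n.
Proof.
rewrite -word_sum_top mulrDr !word_sum_pascal //.
by rewrite !pascalDZ; ring.
Qed.

End FirstLetter.

Arguments word_sum : simpl never.

(** * Agreement of the two recurrences *)

Section Reciprocity.
Local Open Scope ring_scope.

(** At this [t] one has [1 + t = - 2 m], so [word_sum_rec] and [colorings_rec] coincide. The top
    term occurs once on the left and twice on the right, hence is determined by the earlier ones. *)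
Lemma word_sum_colorings m n :
  (-1) ^+ n * word_sum (- (2 * m + 1)%:Z) n 0 true = colorings n 0 m.
Proof.
elim/ltn_ind: n => -[|n] IH //.
set t := - (2 * m + 1)%:Z in IH *.
have := word_sum_rec t n; have := colorings_rec n m.
set z := fun j => (-1) ^+ j.+1 * word_sum t j.+1 0 true.
set w := fun j => colorings j.+1 0 m.
have e1 : pascal z n n - pascal w n n = z n - w n.
  by apply: eq_pascal_below => // j jn; rewrite /z /w IH.
have e0 := @eq_pascal_below (fun j => (-1) ^+ j * word_sum t j 0 true)
  (fun j => colorings j 0 m) n n (leqnn n).
move: e0; rewrite IH // subrr => e0.
have {}e0 := e0 (fun j jn => IH j (leqW jn)).
move/eqP: e0; rewrite subr_eq0 => /eqP ->.
have -> : 1 + t = - (2 * m)%:Z by rewrite /t; lia.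
rewrite mulNr; set q := _ * pascal (fun j => colorings j 0 m) n n.
rewrite -/(z n) -/(w n) => hL hz; lia.
Qed.

End Reciprocity.

(** * The characteristic polynomial *)

Section PointCounting.
Local Open Scope fset_scope.
Local Open Scope ring_scope.
Variables (F : fieldType) (V : vectType F) (A : {fset {vspace V}}).

Lemma memv_bigcap_seq (s : seq {vspace V}) v :
  (v \in (\bigcap_(H <- s) H)%VS) = all (fun H : {vspace V} => v \in H) s.
Proof.
elim: s => [|H s IH]; first by rewrite big_nil memvf.
by rewrite big_cons memv_cap IH.
Qed.

Lemma flatsP (X : {vspace V}) :
  reflect (exists2 B : {fset {vspace V}}, B `<=` A & X = (\bigcap_(H <- B) H)%VS)
    (X \in flats A).
Proof.
apply: (iffP (imfsetP _ _ _ _)) => -[B /= BA ->]; exists B => //.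
  by move: BA; rewrite fpowersetE.
by rewrite fpowersetE.
Qed.

Lemma flats_full : fullv \in flats A.
Proof. by apply/flatsP; exists fset0; rewrite ?fsub0set // big_seq_fset0. Qed.

(** The flats containing [Y] form the interval from [fullv] to [Y], over which the Moebius recursion
    makes the values cancel unless the interval is a single point. *)
Lemma sum_mobius_flats (Y : {vspace V}) : Y \in flats A ->
  \sum_(X <- flats A | (Y <= X)%VS) mobius (@rev_incl F V) (flats A) fullv X
  = (Y == fullv)%:R.
Proof.
move=> YL.
have lexx : reflexive (@rev_incl F V) by move=> X; exact: subvv.
have leT : transitive (@rev_incl F V).
  by move=> X Y' Z XY YZ; apply: subv_trans YZ XY.
have leA : antisymmetric (@rev_incl F V).
  by move=> X Z /andP[XZ ZX]; apply: subv_anti; apply/andP.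
rewrite big_mkcond (bigD1_seq Y) ?fset_uniq //= subvv -big_mkcondr.
have [->|nY] := eqVneq Y fullv.
  rewrite mobius_xx // big1 ?addr0 // => X /andP[nX fX].
  by case/eqP: nX; apply: subv_anti; rewrite subvf fX.
rewrite mobius_lt // ?flats_full //; last by rewrite eq_sym.
  apply/eqP; rewrite addrC subr_eq0; apply/eqP; apply: eq_bigl => X.
  by rewrite /rev_incl subvf andbC.
exact: subvf.
Qed.

(** Read [q ^ \dim X] as a number of points and exchange the sums: each point collects the Moebius
    values of the flats through it, which add up to 1 off all hyperplanes and to 0 otherwise. *)
Lemma arr_char_poly_count (P : finType) (e : P -> V) (q : nat) :
  fullv \notin A ->
  (forall X, X \in flats A -> #|[set p | e p \in X]| = q ^ \dim X)%N ->
  (arr_char_poly A).[q%:Z] =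
  #|[set p | all (fun H : {vspace V} => e p \notin H) A]|%:Z.
Proof.
move=> nA cX; rewrite /arr_char_poly horner_sum.
pose mu := mobius (@rev_incl F V) (flats A) fullv.
have -> : \sum_(X <- flats A) (mu X *: 'X^(\dim X)).[q%:Z] =
   \sum_(X <- flats A) \sum_(p : P) (if e p \in X then mu X else 0).
  rewrite big_seq [RHS]big_seq; apply: eq_bigr => X XL.
  rewrite hornerZ hornerXn -big_mkcond /= sumr_const.
  by rewrite -[X in _ *+ X]cardsE cX // -[RHS]mulr_natr natrX natz.
rewrite exchange_big /= -sum1_card [RHS](big_morph Posz PoszD erefl).
rewrite [RHS]big_mkcond /=.
apply: eq_bigr => p _; rewrite inE -big_mkcond /=.
(* [Y] is the smallest flat through [e p]: a flat contains [e p] iff it contains [Y]. *)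
pose Y := (\bigcap_(H <- [fset H in A | e p \in H]) H)%VS.
have YL : Y \in flats A.
  by apply/flatsP; exists [fset H in A | e p \in H] => //; exact: fset_sub.
have pY : e p \in Y.
  by rewrite memv_bigcap_seq; apply/allP => H; rewrite !inE => /andP[].
rewrite big_seq_cond (eq_bigl (fun X => (X \in flats A) && (Y <= X)%VS)); last first.
  move=> X; apply: andb_id2l => /flatsP[B /fsubsetP BA ->].
  apply/idP/idP => [|/subvP]; last by apply.
  rewrite memv_bigcap_seq => /allP eB; apply/subvP => v.
  rewrite !memv_bigcap_seq => /allP vY; apply/allP => H HB.
  by apply: vY; rewrite !inE BA //= eB.
rewrite -big_seq_cond sum_mobius_flats //.
case: ifP => [/allP pA|]; last first.
  move/allPn => [H HA]; rewrite negbK => pH.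
  case: eqP => // Yf; case/negP: nA; rewrite -(_ : H = fullv) //.
  apply: subv_anti; rewrite subvf -Yf; apply/subvP => v.
  by rewrite memv_bigcap_seq => /allP; apply; rewrite !inE HA.
suff -> : Y = fullv by rewrite eqxx.
rewrite /Y big1_seq // => H; rewrite !inE => /= /andP[HA pH].
by move: (pA _ HA); rewrite pH.
Qed.

End PointCounting.

Lemma sum_option (T : finType) (f : option T -> nat) :
  (\sum_a f a = f None + \sum_x f (Some x))%N.
Proof.
rewrite (bigD1 None) //=; congr (_ + _)%N.
by rewrite (reindex_omap Some id) => [|[x|]] //=; apply: eq_bigl => x; rewrite eqxx.
Qed.

(** * Box points off the hyperplanes *)

Section Box.
Local Open Scope ring_scope.
Variables (m : nat).

(** The integers from [-m] to [m]: [None] stands for 0 and [Some (i, s)] for [i + 1], negated when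
    [s] holds. *)
Definition level : finType := option ('I_m * bool).

Definition flip (x : 'I_m * bool) := (x.1, ~~ x.2).

Definition neg_level (a : level) : level := omap flip a.

Lemma flipK : involutive flip.
Proof. by case=> i s; rewrite /flip /= negbK. Qed.

Lemma card_level : #|{: level}| = (2 * m + 1)%N.
Proof. by rewrite card_option card_prod card_ord card_bool; lia. Qed.

Section Values.
Variable R : realDomainType.

Definition level_val (a : level) : R :=
  if a is Some x then (if x.2 then -1 else 1) * x.1.+1%:R else 0.

Lemma level_valN a : level_val (neg_level a) = - level_val a.
Proof. by case: a => [[i []]|] /=; rewrite ?oppr0 ?mulN1r ?mul1r ?opprK. Qed.

Lemma level_val_inj : injective level_val.
Proof.
have pos (i : nat) : 0 < i.+1%:R :> R by rewrite ltr0Sn.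
move=> [[i s]|] [[k u]|] //=; last first.
- by move/eqP; case: u; rewrite eq_sym ?mulN1r ?mul1r ?oppr_eq0 pnatr_eq0.
- by move/eqP; case: s; rewrite ?mulN1r ?mul1r ?oppr_eq0 pnatr_eq0.
have := pos i; have := pos k.
case: s; case: u; rewrite ?mulN1r ?mul1r => pk pi.
- by move/oppr_inj/eqP; rewrite eqr_nat => /eqP[] /val_inj ->.
- by move=> e; move: (pk); rewrite -e oppr_gt0 ltNge (ltW pi).
- by move=> e; move: (pi); rewrite e oppr_gt0 ltNge (ltW pk).
- by move/eqP; rewrite eqr_nat => /eqP[] /val_inj ->.
Qed.

End Values.

(* [z] records whether the level 0 is already taken, [U] the other levels. *)
Definition avoids (z : bool) (U : {set 'I_m * bool}) (a : level) : bool :=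
  if a is Some x then flip x \notin U else ~~ z.

Definition proper z U (s : seq level) :=
  all (avoids z U) s && pairwise (fun a b => neg_level b != a) s.

Lemma proper_cons z U a s : proper z U (a :: s) =
  avoids z U a &&
  (if a is Some x then proper z (x |: U) s else proper true U s).
Proof.
rewrite /proper /=; case avz : (avoids z U a) => //=.
rewrite andbCA andbA -all_predI.
case: a avz => [x|] avz; congr (_ && _); apply: eq_all => -[y|] //=.
  by rewrite !inE negb_or; congr (_ && _).
Qed.

Fixpoint num_proper n z (U : {set 'I_m * bool}) : nat :=
  if n is n'.+1 then
    (~~ z * num_proper n' true U
     + \sum_(x | flip x \notin U) num_proper n' z (x |: U))%N
  else 1%N.

Lemma card_proper n z U :
  #|[set s : n.-tuple level | proper z U s]| = num_proper n z U.
Proof.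
elim: n z U => [|n IH] z U.
  rewrite (eq_card (B := predT)); first by rewrite card_tuple expn0.
  by move=> s; rewrite inE tuple0.
rewrite -sum1_card.
pose f (p : level * n.-tuple level) := [tuple of p.1 :: p.2].
pose g (s : n.+1.-tuple level) := (thead s, [tuple of behead s]).
rewrite (reindex f) /=; last first.
  exists g => [[a s] _|s _]; last by rewrite /f /g /= -tuple_eta.
  by rewrite /f /g theadE; congr pair; apply: val_inj.
pose P a (s : n.-tuple level) :=
  if a is Some x then proper z (x |: U) s else proper true U s.
rewrite (eq_bigl (fun p : level * n.-tuple level =>
  avoids z U p.1 && P p.1 p.2)); last first.
  by move=> [a s]; rewrite inE proper_cons.
rewrite -(pair_big_dep (avoids z U) P (fun _ _ => 1%N)) /=.
have cnt z' U' : (\sum_(s : n.-tuple level | proper z' U' s) 1 = num_proper n z' U')%N.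
  by rewrite -IH -sum1_card; apply: eq_bigl => s; rewrite inE.
rewrite big_mkcond sum_option /=; congr (_ + _)%N.
  by case: z @P => P /=; rewrite ?mul0n ?mul1n ?cnt.
rewrite -big_mkcond; apply: eq_bigr => x _; exact: cnt.
Qed.

Definition sign_consistent (U : {set 'I_m * bool}) :=
  forall x, x \in U -> flip x \notin U.

Lemma card_free U : sign_consistent U ->
  (#|[set x | (x \notin U) && (flip x \notin U)]| + 2 * #|U| = 2 * m)%N.
Proof.
move=> cU.
have -> : [set x | (x \notin U) && (flip x \notin U)] = ~: (U :|: flip @: U).
  apply/setP => x; rewrite !inE negb_or; congr (_ && ~~ _).
  by rewrite -{2}(flipK x) mem_imset //; exact: inv_inj flipK.
have dU : U :&: flip @: U = set0.
  apply/setP => x; rewrite !inE; case xU : (x \in U) => //=.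
  rewrite -(flipK x) mem_imset; last exact: inv_inj flipK.
  by apply/negbTE/cU.
have := cardsC (U :|: flip @: U); rewrite cardsU dU cards0 subn0.
rewrite card_imset; last exact: inv_inj flipK.
by rewrite card_prod card_ord card_bool [RHS]mulnC => <-; rewrite mul2n -addnn addnC.
Qed.

(** Levels in [U] act as free colors and the untouched pairs of opposite levels as pairs of colors.
    The second term chooses the coordinate equal to 0: there is at most one, and none if [z]
    holds. *)
Lemma num_properE n z U : sign_consistent U ->
  (num_proper n z U)%:Z = colorings n #|U| (m - #|U|)
    + (~~ z * n)%N%:Z * colorings n.-1 #|U| (m - #|U|).
Proof.
elim: n z U => [|n IH] z U cU; first by rewrite muln0 mul0r addr0.
(* Repeating a level of [U] leaves [U] unchanged; any other choice uses up an untouched pair and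
   adds one element to [U]. *)
rewrite [num_proper _ _ _]/= (bigID (mem U)).
rewrite (eq_bigl (mem U)); last first.
  by move=> x /=; case xU: (x \in U); rewrite ?andbF ?andbT // cU.
rewrite (eq_bigr (fun _ => num_proper n z U)); last first.
  by move=> x xU; congr num_proper; apply/setP => y; rewrite !inE; case: eqP => // ->.
rewrite sum_nat_const !PoszD !PoszM.
rewrite [in X in _ + (_ + X)](big_morph Posz PoszD erefl).
pose v : int := colorings n #|U|.+1 (m - #|U|.+1)
  + (~~ z * n)%N%:Z * colorings n.-1 #|U|.+1 (m - #|U|.+1).
rewrite (eq_bigr (fun _ => v)); last first.
  move=> x /andP[fU xU]; rewrite IH ?cardsU1 ?xU //.
  move=> y; rewrite !inE => /orP[/eqP ->|yU].
    rewrite negb_or fU andbT; apply/eqP => /(congr1 snd) /=; by case: (x.2).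
  rewrite negb_or cU // andbT; apply: contraNneq fU => <-.
  by rewrite flipK.
rewrite (eq_bigl (mem [set x | (x \notin U) && (flip x \notin U)])); last first.
  by move=> x; rewrite !inE andbC.
rewrite sumr_const.
have := card_free cU; set c := #|[set _ | _]| => hc.
have -> : c = (2 * (m - #|U|))%N by lia.
rewrite !IH // /v -mulr_natl natz [colorings n.+1 _ _]/= subnS.
case: n {IH v} => [|n] /=.
  by case: z => /=; rewrite ?mul0n ?mul1n ?mul0r ?addr0 ?mul1r; lia.
case: z => /=; lia.
Qed.

Lemma card_properT n :
  #|[set s : n.-tuple level | pairwise (fun a b => neg_level b != a) s]|%:Z
  = colorings n 0 m + n%:Z * colorings n.-1 0 m.
Proof.
have := @num_properE n false set0 _; rewrite cards0 subn0 mul1n => <-; last first.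
  by move=> x; rewrite inE.
rewrite -card_proper; congr (Posz #|pred_of_set _|).
apply/setP => s; rewrite !inE /proper (eq_all (a2 := predT)) ?all_predT //.
by case => [x|] //=; rewrite inE.
Qed.

End Box.

(** * Box points on flats *)

Section Flats.
Local Open Scope ring_scope.
Variables (R : realType) (n : nat).
Implicit Types (X : {vspace 'rV[R]_n}) (B : {set 'I_n}).

Definition is_sign (c : int) := [|| c == 0, c == 1 | c == -1].

Lemma is_signM c d : is_sign c -> is_sign d -> is_sign (c * d).
Proof. by move=> /or3P[]/eqP-> /or3P[]/eqP->. Qed.

Lemma is_signN c : is_sign c -> is_sign (- c).
Proof. by move=> /or3P[]/eqP->. Qed.

(* [X] is cut out by the equations [x i = s i * x (r i)], the coordinates in
   [B] being free. *)
Record parametrized X B (r : 'I_n -> 'I_n) (s : 'I_n -> int) : Prop := {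
  par_free : forall i, i \in B -> r i = i /\ s i = 1;
  par_sign : forall i, is_sign (s i);
  par_rep : forall i, s i != 0 -> r i \in B;
  par_mem : forall x, (x \in X) = [forall i, x ord0 i == (s i)%:~R * x ord0 (r i)];
  par_dim : \dim X = #|B| }.

Lemma parametrized_full : parametrized fullv setT id (fun=> 1).
Proof.
split => // [i|x|]; first by rewrite inE.
  by rewrite memvf; apply/esym/forallP => i; rewrite mul1r.
by rewrite dimvf /dim /= mul1n cardsT card_ord.
Qed.

Lemma dim_cap_lker X (f : 'Hom('rV[R]_n, R^o)) x :
  x \in X -> f x != 0 -> \dim X = (\dim (X :&: lker f)).+1.
Proof.
move=> xX fx; rewrite -(limg_ker_dim f X) -[RHS]addn1; congr (_ + _)%N.
apply/eqP; rewrite eqn_leq; apply/andP; split.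
  have := dimvS (subvf (f @: X)%VS); by rewrite dimvf /dim /=.
rewrite lt0n dimv_eq0; apply: contraNneq fx => f0.
by rewrite -memv0 -f0 memv_img.
Qed.

(** The new equation eliminates the free coordinate [b]: whatever was expressed through [b] is now
    expressed through [a], or vanishes when [c = 0]. *)
Lemma parametrized_cap X B r s (f : 'Hom('rV[R]_n, R^o)) a b (c : int) :
  parametrized X B r s -> b \in B -> is_sign c ->
  (c != 0 -> (a \in B) && (a != b)) ->
  (forall x, x \in X -> (f x == 0) = (x ord0 b == c%:~R * x ord0 a)) ->
  parametrized (X :&: lker f)%VS (B :\ b) (fun k => if r k == b then a else r k)
    (fun k => if r k == b then s k * c else s k).
Proof.
move=> [pf ps pr pm pd] bB cs ca fE.
have [rb sb] := pf b bB.
split.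
- by move=> i; rewrite !inE => /andP[ib /pf[ri si]]; rewrite ri (negbTE ib).
- by move=> i; case: ifP => // _; exact: is_signM.
- move=> i; case: ifP => [/eqP rib|rib si].
    rewrite mulf_eq0 negb_or => /andP[_ /ca /andP[aB ab]].
    by rewrite !inE ab.
  by rewrite !inE rib pr.
- move=> x; rewrite memv_cap memv_ker; apply/andP/forallP => [[xX]|xE].
    rewrite fE // => /eqP xb i; move: (xX); rewrite pm => /forallP /(_ i) /eqP xi.
    by case: (r i =P b) xi => [->|_] -> //; rewrite xb intrM mulrA.
  have xb : x ord0 b = c%:~R * x ord0 a.
    by have /eqP := xE b; rewrite rb eqxx sb mul1r.
  have xX : x \in X.
    rewrite pm; apply/forallP => i; have /eqP xi := xE i.
    case: (r i =P b) xi => [->|_] -> //.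
    by rewrite xb intrM mulrA.
  by rewrite fE // xb.
(* The point of [X] with free coordinate [b] equal to 1 and the other free ones 0 violates the new
   equation, so the dimension drops by one. *)
- pose x : 'rV[R]_n := \row_i ((s i)%:~R * (r i == b)%:R).
  have xX : x \in X.
    rewrite pm; apply/forallP => i; rewrite !mxE.
    have [->|/pr/pf[-> ->]] := eqVneq (s i) 0.
      by rewrite !mul0r.
    by rewrite mul1r.
  have fx : f x != 0.
    rewrite fE // !mxE rb sb eqxx mul1r.
    have [->|/ca /andP[aB ab]] := eqVneq c 0; first by rewrite mul0r oner_eq0.
    by have [-> _] := pf a aB; rewrite (negbTE ab) !mulr0 oner_eq0.
  have := dim_cap_lker xX fx; rewrite pd (cardsD1 b) bB add1n => -[] //.
Qed.

(** On [X] the form involves at most two free coordinates, with coefficients 0, 1 or -1 before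
    merging. It thus vanishes, kills one free coordinate, or ties two of them up to sign. *)
Lemma parametrized_cap_hyperplane X B r s (i j : 'I_n) :
  parametrized X B r s ->
  exists B' r' s', parametrized (X :&: threshold_hyperplane R i j)%VS B' r' s'.
Proof.
move=> pX; have [pf ps pr pm pd] := pX.
pose f := linfun (@coord_sum R n i j).
have fE x : x \in X -> f x = (s i)%:~R * x ord0 (r i) + (s j)%:~R * x ord0 (r j).
  rewrite pm => /forallP xX; rewrite lfunE /= /coord_sum.
  by rewrite {1}(eqP (xX i)) {1}(eqP (xX j)).
have sub : (forall x, x \in X -> f x = 0) -> exists B' r' s',
    parametrized (X :&: threshold_hyperplane R i j)%VS B' r' s'.
  move=> f0; exists B, r, s; suff -> : (X :&: threshold_hyperplane R i j = X)%VS by [].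
  by apply/capv_idPl/subvP => x /f0 fx; rewrite memv_ker fx.
have cut b a c : b \in B -> is_sign c -> (c != 0 -> (a \in B) && (a != b)) ->
  (forall x, x \in X -> (f x == 0) = (x ord0 b == c%:~R * x ord0 a)) ->
  exists B' r' s', parametrized (X :&: threshold_hyperplane R i j)%VS B' r' s'.
  by move=> *; do 3!eexists; apply: parametrized_cap; eauto.
have sgn k : s k != 0 -> s k = 1 \/ s k = -1.
  by move: (ps k) => /or3P[]/eqP-> //; [left|right].
have [si0|si] := eqVneq (s i) 0; have [sj0|sj] := eqVneq (s j) 0.
- by apply: sub => x xX; rewrite fE // si0 sj0 !mul0r addr0.
- apply: (@cut (r j) (r j) 0) => //; first exact: pr.
  move=> x xX; rewrite fE // si0 !mul0r add0r.
  by case: (sgn _ sj) => ->; rewrite ?mul1r ?mulN1r ?oppr_eq0.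
- apply: (@cut (r i) (r i) 0) => //; first exact: pr.
  move=> x xX; rewrite fE // sj0 !mul0r addr0.
  by case: (sgn _ si) => ->; rewrite ?mul1r ?mulN1r ?oppr_eq0.
have [rij|rij] := eqVneq (r i) (r j).
  have [sij|sij] := eqVneq (s i) (s j).
    apply: (@cut (r j) (r j) 0) => //; first exact: pr.
    move=> x xX; rewrite fE // sij rij -mulr2n mul0r -mulr_natr.
    by case: (sgn _ sj) => ->; rewrite ?mul1r ?mulN1r mulf_eq0 ?oppr_eq0 pnatr_eq0 orbF.
  apply: sub => x xX; rewrite fE // rij -mulrDl.
  by move: sij; case: (sgn _ si) => ->; case: (sgn _ sj) => -> // _;
    rewrite ?addrN ?addNr mul0r.
(* The constant comes from solving for coordinate [r j], since [s j] squares to 1. *)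
apply: (@cut (r j) (r i) (- (s i * s j))) => //.
- exact: pr.
- by apply/is_signN/is_signM.
- by rewrite pr.
move=> x xX; rewrite fE //.
case: (sgn _ si) => ->; case: (sgn _ sj) => ->;
  rewrite ?(mulrN, mulNr, mulr1, mul1r, opprK, mulrNz, mulr1z);
  by apply/eqP/eqP => ?; lra.
Qed.

Lemma threshold_arrangementP (H : {vspace 'rV[R]_n}) :
  reflect (exists i j : 'I_n, (i < j)%N /\ H = threshold_hyperplane R i j)
    (H \in threshold_arrangement R n).
Proof.
apply: (iffP (imfsetP _ _ _ _)) => [[[i j] /= ij ->]|[i [j [ij ->]]]].
  by exists i, j.
by exists (i, j).
Qed.

Lemma flat_parametrized X : X \in flats (threshold_arrangement R n) ->
  exists B r s, parametrized X B r s.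
Proof.
move=> /flatsP[C /fsubsetP CA ->].
have {}CA : {subset enum_fset C <= threshold_arrangement R n} by [].
elim: (enum_fset C) CA => [|H s IH] sA.
  by rewrite big_nil; exists setT, id, (fun=> 1); exact: parametrized_full.
have [H1 H1s|B [r [u pX]]] := IH.
  by apply: sA; rewrite in_cons H1s orbT.
have /threshold_arrangementP[i [j [_ ->]]] := sA H (mem_head _ _).
by rewrite big_cons capvC; exact: parametrized_cap_hyperplane pX.
Qed.

Variable m : nat.

Definition box_point (p : n.-tuple (level m)) : 'rV[R]_n :=
  \row_i level_val R (tnth p i).

Definition scale_level (c : int) (a : level m) : level m :=
  if c == 0 then None else if c == 1 then a else neg_level a.

Lemma level_val_scale c a : is_sign c ->
  level_val R (scale_level c a) = c%:~R * level_val R a.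
Proof.
by move=> /or3P[]/eqP->; rewrite /scale_level /= ?mul0r ?mul1r // level_valN mulN1r.
Qed.

(** The box is stable under multiplication by 0, 1 and -1, so the levels of the free coordinates are
    arbitrary and determine the others. *)
Lemma card_box_flat X : X \in flats (threshold_arrangement R n) ->
  #|[set p | box_point p \in X]| = ((2 * m + 1) ^ \dim X)%N.
Proof.
move=> /flat_parametrized[B [r [s [pf ps pr pm ->]]]].
have memX p : (box_point p \in X) =
    [forall i, tnth p i == scale_level (s i) (tnth p (r i))].
  rewrite pm; apply: eq_forallb => i; rewrite !mxE -level_val_scale //.
  by rewrite (inj_eq (@level_val_inj _ _)).
pose h (g : {ffun 'I_n -> level m}) := [tuple scale_level (s i) (g (r i)) | i < n].
have hB g i : i \in B -> tnth (h g) i = g i.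
  by move=> /pf[ri si]; rewrite tnth_mktuple ri si.
(* Setting functions to [None] outside [B] makes the choice on [B] determine them. *)
have -> : [set p | box_point p \in X] =
    h @: [set g in pffun_on None (mem B) predT].
  apply/setP => p; rewrite inE memX; apply/forallP/imsetP => [pE|[g _ -> i]].
    exists [ffun i => if i \in B then tnth p i else None].
      rewrite inE; apply/pffun_onP; split => //.
      by apply/subsetP => i; rewrite !inE ffunE; case: ifP.
    apply: eq_from_tnth => i; rewrite tnth_mktuple ffunE (eqP (pE i)).
    by case: ifP => // rB; case: (eqVneq (s i) 0) => [->//|/pr]; rewrite rB.
  rewrite {1}tnth_mktuple; case: (eqVneq (s i) 0) => [->//|/pr rB].
  by rewrite hB.
rewrite card_in_imset ?cardsE ?card_pffun_on ?card_level // => g g'.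
rewrite !inE => /pffun_onP[gB _] /pffun_onP[g'B _] hgg'.
apply/ffunP => i; case: (boolP (i \in B)) => iB; first by rewrite -!hB // hgg'.
have out (k : {ffun 'I_n -> level m}) : None.-support k \subset B -> k i = None.
  by move=> /subsetP /(_ i); rewrite inE; case: eqP => // _ /(_ isT); rewrite (negbTE iB).
by rewrite !out.
Qed.

Lemma arr_char_poly_threshold :
  (arr_char_poly (threshold_arrangement R n)).[(2 * m + 1)%:Z]
  = colorings n 0 m + n%:Z * colorings n.-1 0 m.
Proof.
rewrite (@arr_char_poly_count _ _ _ _ box_point); last exact: card_box_flat.
  rewrite -card_properT; congr (Posz #|pred_of_set _|).
  apply/setP => p; rewrite !inE; apply/allP/(pairwiseP None) => [pA i j|pP H].
    rewrite !inE size_tuple => ilt jlt ij.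
    have := pA (threshold_hyperplane R (Ordinal ilt) (Ordinal jlt)).
    rewrite mem_threshold_hyperplane !mxE !(tnth_nth None) /= => pij.
    apply: contraNneq (pij _) => [<-|]; first by rewrite level_valN addNr.
    by apply/threshold_arrangementP; exists (Ordinal ilt), (Ordinal jlt).
  move=> /threshold_arrangementP[i [j [ij ->]]].
  rewrite mem_threshold_hyperplane !mxE !(tnth_nth None).
  have := pP i j; rewrite !inE size_tuple => /(_ (ltn_ord i) (ltn_ord j) ij).
  apply: contra; rewrite addr_eq0 -level_valN => /eqP /level_val_inj ->.
  by rewrite eqxx.
apply/negP => /threshold_arrangementP[i [j [ij fH]]].
(* This unit vector has [coord_sum] equal to 1, so no hyperplane is the whole space. *)
have := memvf (delta_mx ord0 i : 'rV[R]_n); rewrite fH mem_threshold_hyperplane.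
rewrite !mxE !eqxx /= (_ : (j == i) = false) ?addr0 ?oner_eq0 //.
by apply/negbTE; rewrite -val_eqE /= neq_ltn ij orbT.
Qed.

End Flats.

(** * Canonical words *)

Section Words.
Local Open Scope ring_scope.
Variable n : nat.
Implicit Types (x y : 'I_n * bool) (u w : seq ('I_n * bool)) (S : seq 'I_n).

(* Letters whose label is smaller than all later ones are the anchors, and [p]
   is the sign of the previous anchor; for [p = false] this counts odd anchors. *)
Fixpoint sign_changes (p : bool) u : nat :=
  if u is x :: u' then
    if all (fun y => (x.1 < y.1)%N) u' then ((p != x.2) + sign_changes x.2 u')%N
    else sign_changes p u'
  else 0%N.

(* [(a, s0)] stands for the preceding letter; [a = 0] imposes no constraint. *)
Fixpoint canonical (a : nat) (s0 : bool) u : bool :=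
  if u is x :: u' then
    ((x.2 != s0) || (a <= x.1)%N) && canonical x.1 x.2 u'
  else true.

Definition letters S : seq ('I_n * bool) :=
  [seq (v, s) | v <- S, s <- [:: true; false]].

Fixpoint canonical_words k S (a : nat) (s0 : bool) : seq (seq ('I_n * bool)) :=
  if k is k'.+1 then
    flatten [seq [seq x :: u | u <- canonical_words k' (rem x.1 S) x.1 x.2] |
      x <- [seq x : 'I_n * bool <- letters S |
            (x.2 != s0) || (a <= x.1)%N]]
  else [:: [::]].

Lemma mem_letters S x : (x \in letters S) = (x.1 \in S).
Proof.
apply/allpairsP/idP => [[[v s] /= [vS _ ->]] //|xS].
by exists x; case: x xS => v [].
Qed.

Lemma mem_canonical_words k S a s0 u : size S = k ->
  (u \in canonical_words k S a s0) = perm_eq (unzip1 u) S && canonical a s0 u.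
Proof.
elim: k S a s0 u => [|k IH] S a s0 u szS.
  rewrite (size0nil szS) /= inE; case: u => [|x u] //.
  by apply/esym/negbTE; apply: contraTN isT => /andP[/perm_size].
apply/flatten_mapP/andP => [[x]|].
  rewrite mem_filter mem_letters => /andP[xc xS] /mapP[u'].
  rewrite IH ?size_rem ?szS // => /andP[pu cu] -> /=; rewrite xc cu; split => //.
  by rewrite perm_sym; apply: perm_trans (perm_to_rem xS) _; rewrite perm_cons perm_sym.
case: u => [[/perm_size]|x u /= [pu /andP[xc cu]]]; first by rewrite szS.
have xS : x.1 \in S by rewrite -(perm_mem pu) mem_head.
exists x; first by rewrite mem_filter xc mem_letters.
apply: map_f; rewrite IH ?size_rem ?szS // cu andbT.
by rewrite -(perm_cons x.1); apply: perm_trans pu (perm_to_rem xS).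
Qed.

Lemma uniq_canonical_words k S a s0 : uniq S -> uniq (canonical_words k S a s0).
Proof.
elim: k S a s0 => [|k IH] S a s0 uS //=.
apply: allpairs_uniq_dep => [|x _|].
- by apply/filter_uniq/allpairs_uniq => // -[v s] [v' s'] _ _ [-> ->].
- by apply/IH/rem_uniq.
- by move=> [x u] [x' u'] _ _ /= [-> ->].
Qed.

Lemma big_canonical_words k S a s0 (P : pred (seq ('I_n * bool)))
    (f : seq ('I_n * bool) -> int) :
  \sum_(u <- canonical_words k.+1 S a s0 | P u) f u =
  \sum_(v <- S) \sum_(s <- [:: true; false])
    if (s != s0) || (a <= v)%N then
      \sum_(u <- canonical_words k (rem v S) v s | P ((v, s) :: u)) f ((v, s) :: u)
    else 0.
Proof.
rewrite /= big_flatten big_map big_filter big_mkcond /letters big_allpairs /=.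
apply: eq_bigr => v _; apply: eq_bigr => s _ /=.
by case: ifP => // _; rewrite big_map.
Qed.

Definition rank S (v : nat) : nat := count (fun w : 'I_n => (w < v)%N) S.

Lemma rank_mono S (v : 'I_n) (a : nat) :
  v \in S -> (v < a)%N -> (rank S v < rank S a)%N.
Proof.
move=> vS va; have rankE k : rank S k = ((v < k) + rank (rem v S) k)%N.
  by rewrite /rank (seq.permP (perm_to_rem vS)).
rewrite !rankE ltnn va.
by rewrite add0n add1n ltnS; apply: sub_count => w /= /ltn_trans; apply.
Qed.

Lemma leq_rank S (v : 'I_n) (a : nat) :
  v \in S -> (rank S a <= rank S v)%N = (a <= v)%N.
Proof.
move=> vS; case: (leqP a v) => av; last first.
  by apply/negbTE; rewrite -ltnNge; exact: rank_mono.
by apply: sub_count => w /= /leq_trans; apply.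
Qed.

Lemma rank_rem S (v : 'I_n) : v \in S -> rank (rem v S) v = rank S v.
Proof. by move=> vS; rewrite /rank (seq.permP (perm_to_rem vS)) /= ltnn. Qed.

Lemma rank_eq0 S (v : nat) : (rank S v == 0%N) = all (fun w : 'I_n => (v <= w)%N) S.
Proof.
rewrite -leqn0 leqNgt -has_count -all_predC.
by apply: eq_all => w /=; rewrite -leqNgt.
Qed.

(** Ranks of distinct labels are distinct and below [size S], so they exhaust that range. Word
    counts therefore depend only on relative order. *)
Lemma sum_rank S (g : nat -> int) : uniq S ->
  \sum_(v <- S) g (rank S v) = \sum_(0 <= k < size S) g k.
Proof.
move=> uS; rewrite -(big_map (fun v : 'I_n => rank S v) xpredT g) /index_iota subn0.
apply: perm_big; set s := map _ _.
have us : uniq s.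
  rewrite map_inj_in_uniq // => v w vS wS rvw; apply/val_inj/eqP.
  by rewrite eqn_leq -!(@leq_rank S) // rvw leqnn.
apply: uniq_perm; rewrite ?iota_uniq //.
have [||] := @uniq_min_size _ s (iota 0 (size S)) us; last by [].
  move=> r /mapP[v vS ->]; rewrite mem_iota /= add0n /rank.
  rewrite ltn_neqAle count_size andbT -all_count.
  by apply/allPn; exists v => //; rewrite /= ltnn.
by rewrite size_iota size_map.
Qed.

Lemma unzip1_canonical_word k S a s0 u : size S = k ->
  u \in canonical_words k S a s0 -> perm_eq (unzip1 u) S.
Proof. by move=> szS; rewrite mem_canonical_words // => /andP[]. Qed.

Lemma all_gt_canonical_word k S a s0 u (v : 'I_n) : size S = k -> v \notin S ->
  u \in canonical_words k S a s0 ->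
  all (fun y => (v < y.1)%N) u = (rank S v == 0%N).
Proof.
move=> szS vS /(unzip1_canonical_word szS) pu.
rewrite rank_eq0 -(perm_all _ pu) all_map; apply: eq_in_all => y yu /=.
rewrite ltn_neqAle; case: eqP => //= /val_inj vy; case/negP: vS.
by rewrite vy -(perm_mem pu) map_f.
Qed.

(** * Weights of canonical words *)

Section Sums.
Variable t : int.

Definition weight p k S a s0 : int :=
  \sum_(u <- canonical_words k S a s0) t ^+ sign_changes p u.

(** The first label is an anchor iff its rank is 0, and then its sign becomes the reference. The
    last hypothesis is the induction hypothesis of [weightE]. *)
Lemma weight_cons k S (v : 'I_n) s p : uniq S -> size S = k.+1 -> v \in S ->
  (forall S a s0 p, uniq S -> size S = k ->
    weight p k S a s0 = word_sum t k (rank S a) (s0 == p)) ->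
  \sum_(u <- canonical_words k (rem v S) v s) t ^+ sign_changes p ((v, s) :: u)
  = word_step t k (rank S v) (s == p).
Proof.
move=> uS szS vS IH.
have sz' : size (rem v S) = k by rewrite size_rem // szS.
have v' : v \notin rem v S by rewrite mem_rem_uniq // inE eqxx.
rewrite (eq_big_seq (fun u => if rank S v == 0%N then
   (if s == p then 1 else t) * t ^+ sign_changes s u
   else t ^+ sign_changes p u)); last first.
  move=> u uc /=; rewrite (all_gt_canonical_word sz' v' uc) rank_rem //.
  case: ifP => // _; rewrite exprD eq_sym.
  by case: (s == p).
rewrite /word_step; case: eqP => r0; last first.
  by have := IH (rem v S) v s p (rem_uniq _ uS) sz'; rewrite rank_rem.
rewrite -big_distrr /=; congr (_ * _).
by have := IH (rem v S) v s s (rem_uniq _ uS) sz'; rewrite rank_rem // r0 eqxx.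
Qed.

Lemma weightE k S a s0 p : uniq S -> size S = k ->
  weight p k S a s0 = word_sum t k (rank S a) (s0 == p).
Proof.
elim: k S a s0 p => [|k IH] S a s0 p uS szS.
  by rewrite /weight big_seq1.
rewrite /weight big_canonical_words word_sumS -szS -sum_rank //.
rewrite big_seq [RHS]big_seq; apply: eq_bigr => v vS.
rewrite big_cons big_seq1 leq_rank // !weight_cons //.
by case: s0; case: p; case: (a <= v)%N; rewrite ?mul0r ?mul1r ?addr0 ?add0r //= addrC.
Qed.

Definition start_sign u : bool := if u is x :: _ then x.2 else false.

(** Raising the bound to [n], above every label, forbids repeating [s0] and so selects exactly these
    words. *)
Lemma weight_opposite k S a s0 p : uniq S -> size S = k.+1 ->
  \sum_(u <- canonical_words k.+1 S a s0 | start_sign u != s0) t ^+ sign_changes p u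
  = word_sum t k.+1 k.+1 (s0 == p).
Proof.
move=> uS szS; have rn : rank S n = k.+1.
  by rewrite /rank -szS; apply/eqP; rewrite -all_count; apply/allP => v _ /=.
rewrite -[X in word_sum _ _ X _]rn -weightE // /weight !big_canonical_words.
apply: eq_bigr => v _; apply: eq_bigr => s _ /=.
rewrite (leqNgt n) ltn_ord /= orbF; case: eqP => //= ss.
by case: ifP => // _; rewrite big1_seq.
Qed.

Lemma weight_same k S a s0 p : uniq S -> size S = k.+1 ->
  \sum_(u <- canonical_words k.+1 S a s0 | start_sign u == s0) t ^+ sign_changes p u
  = word_sum t k.+1 (rank S a) (s0 == p) - word_sum t k.+1 k.+1 (s0 == p).
Proof.
move=> uS szS; rewrite -weightE // -(@weight_opposite k S a) // /weight.
by rewrite [in RHS](bigID (fun u => start_sign u == s0)) /= addrK.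
Qed.

Definition std_start u : bool :=
  if u is x :: u' then start_sign u' == x.2 else true.

(* In a standard word the label 0 lies in the first block iff it comes first;
   the convention then adds it with sign +, whatever its sign in the word. *)
Definition odd_stat u : nat :=
  if u is x :: u' then
    if x.1 == 0%N :> nat then (sign_changes true u').+1 else sign_changes false u
  else 0%N.

Lemma sum_odd_stat k S s0 : uniq S -> size S = k.+2 ->
  (exists2 v : 'I_n, v \in S & v = 0%N :> nat) ->
  \sum_(u <- canonical_words k.+2 S 0 s0 | std_start u) t ^+ odd_stat u
  = word_sum t k.+2 0 true - k.+2%:Z * word_sum t k.+1 0 true.
Proof.
move=> uS szS [o oS o0].
rewrite big_canonical_words.
pose g r := word_step t k.+1 r true + word_step t k.+1 r false - word_sum t k.+1 0 true.
transitivity (\sum_(v <- S) g (rank S v)); last first.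
  rewrite sum_rank // szS /g big_split /= sumr_const_nat subn0.
  rewrite -mulr_natl natz mulrN; congr (_ - _); rewrite word_sumS; apply: eq_bigr => i _.
  by rewrite mul1r addrC.
rewrite big_seq [RHS]big_seq; apply: eq_bigr => v vS.
have sz' : size (rem v S) = k.+1 by rewrite size_rem // szS.
have u' := rem_uniq v uS.
have r0 : (rank S v == 0%N) = (v == 0%N :> nat).
  rewrite rank_eq0; apply/allP/eqP => [/(_ o oS)|-> //].
  by rewrite o0 leqn0 => /eqP.
rewrite big_cons big_seq1 !orbT /= /g /word_step r0 -(word_sum_top t k).
case: eqP => v0.
  have E s : \sum_(u <- canonical_words k.+1 (rem v S) v s | start_sign u == s)
     t ^+ (sign_changes true u).+1 =
     t * (word_sum t k.+1 0 true - word_sum t k.+1 k.+1 s).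
    under eq_bigr do rewrite exprS.
    by rewrite -big_distrr weight_same // v0 /rank /= count_pred0 word_sum0 eqb_id.
  rewrite !E -word_sum_top; ring.
have nall s u : u \in canonical_words k.+1 (rem v S) v s ->
    all (fun y : 'I_n * bool => v < y.1)%N u = false.
  move=> uc; rewrite (all_gt_canonical_word sz' _ uc) ?rank_rem ?r0; [exact/eqP|by []|].
  by rewrite mem_rem_uniq // inE eqxx.
have E s : \sum_(u <- canonical_words k.+1 (rem v S) v s | start_sign u == s)
   t ^+ (if all (fun y : 'I_n * bool => v < y.1)%N u
         then (false != s) + sign_changes s u else sign_changes false u)%N =
   word_sum t k.+1 (rank S v) (s == false) - word_sum t k.+1 k.+1 (s == false).
  rewrite -(rank_rem vS) -weight_same // big_seq_cond [RHS]big_seq_cond.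
  by apply: eq_bigr => u /andP[uc _]; rewrite (nall s).
rewrite !E /=; ring.
Qed.

End Sums.
End Words.

(** * Graphs of words and their normal forms *)

Section WordGraphs.
Variable n : nat.
Implicit Types (x y : 'I_n * bool) (u w : seq ('I_n * bool)) (a b : 'I_n).

Fixpoint word_adj u a b : bool :=
  if u is x :: u' then
    [|| (a == x.1) && ((b, true) \in u'), (b == x.1) && ((a, true) \in u')
      | word_adj u' a b]
  else false.

Lemma word_adj_sym u a b : word_adj u a b = word_adj u b a.
Proof. by elim: u => //= x u ->; rewrite orbCA. Qed.

Lemma word_adj_swap x y u : x.2 = y.2 ->
  word_adj (x :: y :: u) =2 word_adj (y :: x :: u).
Proof.
case: x y => [v s] [v' s'] /= -> a b; rewrite !inE !xpair_eqE.
case: s'; do !case: (_ == _) => //=; do !case: (_ \in _) => //=.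
Qed.

Lemma word_adj_cons x u w : u =i w -> word_adj u =2 word_adj w ->
  word_adj (x :: u) =2 word_adj (x :: w).
Proof. by move=> uw adj a b /=; rewrite !uw adj. Qed.

(** Only behind [y] can [x] be an anchor; then [y] is the anchor just before it, with the same sign,
    so [x] adds nothing. *)
Lemma sign_changes_swap p x y u : x.2 = y.2 -> (y.1 < x.1)%N ->
  sign_changes p (x :: y :: u) = sign_changes p (y :: x :: u).
Proof.
case: x y => [v s] [v' s'] /= -> lt; rewrite lt /= (ltnNge v) (ltnW lt) /=.
case: ifP => al.
  by rewrite eqxx add0n; case: ifP.
case: ifP => // al'; case/negP: (negbT al).
by apply/allP => y yu; apply: ltn_trans lt (allP al' y yu).
Qed.

Lemma sign_changes_cons x u w : perm_eq u w ->
  (forall p, sign_changes p u = sign_changes p w) ->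
  forall p, sign_changes p (x :: u) = sign_changes p (x :: w).
Proof. by move=> uw sc p /=; rewrite (perm_all _ uw) !sc. Qed.

(** Insertion stops at a sign change, so it only exchanges neighbours of equal sign. *)
Fixpoint insert x u :=
  if u is y :: u' then
    if (x.2 == y.2) && (y.1 < x.1)%N then y :: insert x u' else x :: u
  else [:: x].

Lemma perm_insert x u : perm_eq (insert x u) (x :: u).
Proof.
elim: u => //= y u IH; case: ifP => // _.
rewrite -(perm_cons y) in IH; apply: perm_trans IH _.
exact: permEl (perm_catCA [:: y] [:: x] u).
Qed.

Lemma word_adj_insert x u : word_adj (insert x u) =2 word_adj (x :: u).
Proof.
elim: u => // y u IH; rewrite [insert _ _]/=; case: ifP => // /andP[/eqP xy _] a b.
by rewrite (word_adj_cons y (perm_mem (perm_insert x u)) IH) word_adj_swap.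
Qed.

Lemma sign_changes_insert x u p :
  sign_changes p (insert x u) = sign_changes p (x :: u).
Proof.
elim: u p => // y u IH p; rewrite [insert _ _]/=; case: ifP => // /andP[/eqP xy lt].
by rewrite (sign_changes_cons y (perm_insert x u) IH) [RHS]sign_changes_swap.
Qed.

Lemma canonical_insert x u v s : (x.2 != s) || (v <= x.1)%N ->
  canonical v s u -> canonical v s (insert x u).
Proof.
elim: u v s => [|y u IH] v s xc /=; first by rewrite xc.
move=> /andP[yc cu]; case: ifP => [/andP[/eqP xy lt]|]; rewrite /= ?yc ?xc ?cu ?andbT /=.
  by apply: IH => //; rewrite (ltnW lt) orbT.
by move/negbT; rewrite negb_and -leqNgt eq_sym.
Qed.

Lemma start_sign_insert x u : start_sign (insert x u) = x.2.
Proof. by case: u => //= y u; case: ifP => // /andP[/eqP]. Qed.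

Lemma std_start_insert x u : start_sign u = x.2 -> std_start (insert x u) || (u == [::]).
Proof.
case: u => [|y u] /= yx; [by rewrite orbT|rewrite orbF].
case: ifP => [/andP[/eqP xy _]|_] /=.
  by rewrite start_sign_insert xy.
by rewrite yx.
Qed.

Definition word_sort u := foldr insert [::] u.

Lemma perm_word_sort u : perm_eq (word_sort u) u.
Proof.
elim: u => //= x u IH; apply: perm_trans (perm_insert _ _) _.
by rewrite perm_cons.
Qed.

Lemma word_adj_sort u : word_adj (word_sort u) =2 word_adj u.
Proof.
elim: u => //= x u IH a b; rewrite word_adj_insert.
exact: word_adj_cons (perm_mem (perm_word_sort u)) IH a b.
Qed.

Lemma sign_changes_sort u p : sign_changes p (word_sort u) = sign_changes p u.
Proof.
elim: u p => // x u IH p; rewrite [word_sort _]/= sign_changes_insert.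
exact: sign_changes_cons (perm_word_sort u) IH p.
Qed.

Lemma canonical_sort u s : canonical 0 s (word_sort u).
Proof.
suff H v : canonical 0 v (word_sort u) by exact: H.
by elim: u => //= x u IH; apply: canonical_insert => //; rewrite leq0n orbT.
Qed.

(* The sign of the first letter does not affect the graph; [retype] copies the
   sign of the second letter onto it. *)
Definition retype u := if u is x :: y :: u' then [:: (x.1, y.2), y & u'] else u.

Definition standardize u := word_sort (retype u).

Lemma unzip1_retype u : unzip1 (retype u) = unzip1 u.
Proof. by case: u => [|x [|y u]]. Qed.

Lemma word_adj_standardize u : word_adj (standardize u) =2 word_adj u.
Proof. by move=> a b; rewrite word_adj_sort; case: u => [|x [|y u]]. Qed.

Lemma perm_standardize u : perm_eq (unzip1 (standardize u)) (unzip1 u).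
Proof. by rewrite -(unzip1_retype u); apply/perm_map/perm_word_sort. Qed.

Lemma canonical_standardize u s : canonical 0 s (standardize u).
Proof. exact: canonical_sort. Qed.

(** Retyping puts the first two letters into one block, and sorting permutes letters only inside
    blocks. *)
Lemma std_start_standardize u : 1 < size u -> std_start (standardize u).
Proof.
case: u => [|x [|y u]] // _; rewrite /standardize /=.
have := @std_start_insert (x.1, y.2) (insert y (word_sort u)).
rewrite start_sign_insert => /(_ erefl) /orP[//|/eqP e].
by have := perm_size (perm_insert y (word_sort u)); rewrite e.
Qed.

Lemma word_adj_mem u a b : word_adj u a b -> (a \in unzip1 u) && (b \in unzip1 u).
Proof.
elim: u => //= x u IH; rewrite !inE => /or3P[/andP[-> bu]|/andP[-> au]|/IH/andP[-> ->]].
- by rewrite (map_f fst bu) orbT.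
- by rewrite (map_f fst au) orbT.
- by rewrite !orbT.
Qed.

Lemma mem_uniq_letter u x : uniq (unzip1 u) -> x \in u -> ((x.1, true) \in u) = x.2.
Proof.
move=> uu xu; case x2 : (x.2); first by case: x xu x2 => v [].
apply/negP => xt.
have : x = (x.1, true).
  move: uu xu xt; elim: u => //= y u IH /andP[yu uu]; rewrite !inE.
  move=> /orP[/eqP xy|xu] /orP[/eqP h|xt].
  - by rewrite h xy.
  - by case/negP: yu; rewrite -xy (map_f fst xt).
  - by case/negP: yu; rewrite -h (map_f fst xu).
  - exact: IH.
by move=> /(congr1 snd); rewrite x2.
Qed.

Lemma word_adj_split u1 x u2 y u3 (u := u1 ++ x :: u2 ++ y :: u3) :
  uniq (unzip1 u) -> word_adj u x.1 y.1 = y.2.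
Proof.
rewrite {}/u; elim: u1 => [|z u1 IH] /=.
  set r := u2 ++ _ => /andP[xr ur].
  have yr : y \in r by rewrite mem_cat mem_head orbT.
  have nadj : word_adj r x.1 y.1 = false.
    by apply/negP => /word_adj_mem /andP[]; rewrite (negbTE xr).
  have xy : (y.1 == x.1) = false.
    by apply: contraNF xr => /eqP <-; rewrite (map_f fst yr).
  by rewrite eqxx xy nadj mem_uniq_letter // !orbF.
set r := u1 ++ _ => /andP[zr ur]; rewrite (IH ur).
have xr : x \in r by rewrite mem_cat mem_head orbT.
have yr : y \in r by rewrite mem_cat inE mem_cat mem_head !orbT.
have -> : (x.1 == z.1) = false by apply: contraNF zr => /eqP <-; rewrite (map_f fst xr).
by have -> : (y.1 == z.1) = false by apply: contraNF zr => /eqP <-; rewrite (map_f fst yr).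
Qed.

Lemma word_adj_rcons u x a b : word_adj (rcons u x) a b =
  word_adj u a b ||
  x.2 && ((a == x.1) && (b \in unzip1 u) || (b == x.1) && (a \in unzip1 u)).
Proof.
case: x => v s; elim: u => [|y u IH] /=; first by rewrite !andbF.
rewrite {}IH !mem_rcons !inE !xpair_eqE /=.
by case: s; do !case: (_ == _) => //=; do !case: (_ \in _) => //=; rewrite ?orbT ?orbF.
Qed.

Lemma canonical_cat v s u w : canonical v s (u ++ w) ->
  canonical v s u &&
  (if u is x :: u' then canonical (last x u').1 (last x u').2 w
   else canonical v s w).
Proof.
elim: u v s => //= x u IH v s /andP[-> /IH]; case: u {IH} => //=.
Qed.

Lemma canonical_const v s u : canonical v s u -> all (fun y => y.2 == s) u ->
  all (fun y => v <= y.1)%N u.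
Proof.
elim: u v s => //= x u IH v s /andP[xc cu] /andP[/eqP xs us].
rewrite xs eqxx /= in xc; rewrite xc /=.
rewrite xs in cu; have := IH _ _ cu us; apply: sub_all => y; exact: leq_trans.
Qed.

(* A vertex adjacent to all the others, or to none of them, belongs to the
   last block, hence has a label at most that of the last letter. *)
Lemma leq_last_letter u v s a s0 : uniq (unzip1 (rcons u (v, s))) ->
  canonical 0 s0 (rcons u (v, s)) -> std_start (rcons u (v, s)) ->
  a \in unzip1 (rcons u (v, s)) ->
  (forall b, b \in unzip1 (rcons u (v, s)) -> b != a ->
    word_adj (rcons u (v, s)) a b = s) ->
  (a <= v)%N.
Proof.
move=> uu cu su /mapP[[a' r]]; set U := rcons u (v, s) => aU /= ea; subst a' => adjs.
have vU : (v, s) \in U by rewrite mem_rcons mem_head.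
have [u1 [u2 EU]] : exists u1 u2, U = u1 ++ (a, r) :: u2.
  by have [u1 u2] := splitPr aU; exists u1, u2.
have lastU : last (a, r) u2 = (v, s).
  by have := congr1 (last (a, r)) EU; rewrite last_rcons last_cat /= => <-.
case: (altP (u2 =P [::])) => [u20|u2n].
  by move: lastU; rewrite u20 /= => -[-> _].
have uU : uniq (unzip1 (u1 ++ (a, r) :: u2)) by rewrite -EU.
have neq y : y \in u1 ++ u2 -> y.1 != a.
  move=> yu; move: uU; rewrite /unzip1 map_cat map_cons -cat1s uniq_catCA cat1s.
  rewrite cons_uniq -map_cat.
  move=> /andP[au _]; apply: contraNneq au => /= <-.
  exact: (map_f fst yu).
(* Adjacency of [a] with a later letter is the sign of that letter. *)
have s2 : all (fun y => y.2 == s) u2.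
  apply/allP => y yu2.
  have [w1 [w2 E2]] : exists w1 w2, u2 = w1 ++ y :: w2.
    by have [w1 w2] := splitPr yu2; exists w1, w2.
  have h := @word_adj_split u1 (a, r) w1 y w2; rewrite -E2 -EU in h.
  rewrite -(h uu) adjs //; last by apply: neq; rewrite mem_cat yu2 orbT.
  by rewrite map_f // EU mem_cat inE yu2 !orbT.
(* The sign of [a] shows in its adjacency with the first letter; if [a] comes first itself,
   [std_start] equates its sign with the second one. *)
have rs : r = s.
  case: u1 EU uU neq => [|y u1] EU uU neq.
    move: su; rewrite -/U EU /=.
    case: u2 {lastU uU neq EU} u2n s2 => //= z u2 _ /andP[/eqP <- _].
    by move/eqP.
  have h := @word_adj_split [::] y u1 (a, r) u2.
  rewrite -[[::] ++ _]/((y :: u1) ++ (a, r) :: u2) -EU in h.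
  transitivity (word_adj U y.1 a); first exact: esym (h uu).
  rewrite word_adj_sym adjs //; last by apply: neq; rewrite mem_head.
  by rewrite EU mem_head.
have : canonical a s u2.
  move: cu; rewrite -/U EU => /canonical_cat/andP[_].
  by case: u1 {EU uU neq} => [|y u1] /= /andP[_]; rewrite rs.
move=> /canonical_const /(_ s2) /allP /(_ (v, s)); apply.
by move: lastU; case: u2 u2n {EU uU neq s2} => //= z u2 _ <-; rewrite mem_last.
Qed.

(** Letters are recovered from the right: the last vertex is adjacent to all others or to none,
    which fixes its sign, and [leq_last_letter] used both ways fixes its label. *)
Lemma standard_word_inj u w s0 : 1 < size u -> uniq (unzip1 u) ->
  perm_eq (unzip1 u) (unzip1 w) -> word_adj u =2 word_adj w ->
  canonical 0 s0 u -> std_start u -> canonical 0 s0 w -> std_start w -> u = w.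
Proof.
elim/last_ind: u w => // u [v s] IH w; rewrite size_rcons ltnS => u0.
elim/last_ind: w => [|w [v' s'] _] uu puw adj cu su cw sw.
  by have := perm_size puw; rewrite !size_map size_rcons.
have uw : uniq (unzip1 (rcons w (v', s'))) by rewrite -(perm_uniq puw).
have adjlast r x b : uniq (unzip1 (rcons r x)) -> b \in unzip1 (rcons r x) ->
    b != x.1 -> word_adj (rcons r x) x.1 b = x.2.
  move=> ur /mapP[y yr ->] yx; move: yr; rewrite mem_rcons inE => /orP[/eqP yE|yr].
    by rewrite yE eqxx in yx.
  have [r1 [r2 E]] : exists r1 r2, r = r1 ++ y :: r2.
    by have [r1 r2] := splitPr yr; exists r1, r2.
  rewrite word_adj_sym; have := @word_adj_split r1 y r2 x [::].
  by rewrite cats1 -rcons_cons -rcons_cat -E; apply.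
have mv : v \in unzip1 (rcons u (v, s)) by rewrite /unzip1 map_rcons mem_rcons mem_head.
have mv' : v' \in unzip1 (rcons w (v', s')) by rewrite /unzip1 map_rcons mem_rcons mem_head.
have ss' : s = s'.
  have [vv'|vv'] := eqVneq v v'; last first.
    have e1 : word_adj (rcons u (v, s)) v v' = s.
      by apply: (adjlast u (v, s)); rewrite ?(perm_mem puw) //= eq_sym.
    have e2 : word_adj (rcons w (v', s')) v' v = s'.
      by apply: (adjlast w (v', s')); rewrite -?(perm_mem puw).
    by rewrite -[LHS]e1 -[RHS]e2 adj word_adj_sym.
  case: u u0 uu puw adj {IH cu su cw sw uw mv} => // y u _ uu puw adj.
  have yv : y.1 != v.
    move: uu => /= /andP[+ _]; rewrite /unzip1 map_rcons mem_rcons inE negb_or => /andP[].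
    by [].
  have my : y.1 \in unzip1 (rcons (y :: u) (v, s)) by rewrite mem_head.
  transitivity (word_adj (rcons (y :: u) (v, s)) v y.1).
    exact: esym (adjlast _ _ _ uu my yv).
  rewrite adj vv'; apply: (adjlast w (v', s')) => //.
  - by rewrite -(perm_uniq puw).
  - by rewrite -(perm_mem puw).
  - by rewrite -vv'.
subst s'.
have vv' : v = v'.
  apply/val_inj/eqP; rewrite eqn_leq; apply/andP; split.
    apply: (leq_last_letter uw cw sw); first by rewrite -(perm_mem puw).
    by move=> b; rewrite -(perm_mem puw) -adj => bu bv; apply: (adjlast u (v, s)).
  apply: (leq_last_letter uu cu su); first by rewrite (perm_mem puw).
  by move=> b; rewrite (perm_mem puw) adj => bu bv; apply: (adjlast w (v', s)).
subst v'.
have puw' : perm_eq (unzip1 u) (unzip1 w).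
  by move: puw; rewrite /unzip1 !map_rcons -!cats1 perm_cat2r.
have [vu uu'] : v \notin unzip1 u /\ uniq (unzip1 u).
  by move: uu; rewrite /unzip1 map_rcons rcons_uniq => /andP[].
(* When one letter remains, its label is forced and [std_start] gives it the sign of the letter just
   removed. *)
congr rcons; case: (ltnP 1 (size u)) => u1; last first.
  have /eqP : size u = 1 by apply/eqP; rewrite eqn_leq u1.
  have /perm_size := puw'; rewrite !size_map => ->.
  move: puw' su sw u1 u0 {cu cw uu uw puw adj IH mv mv' vu uu'}.
  case: u => [|[y r] []] //; case: w => [|[y' r'] []] //= p /eqP <- /eqP <- _ _ _.
  by have := perm_mem p y; rewrite !inE eqxx => /esym /eqP ->.
apply: IH => //.
- move=> a b; have := adj a b; rewrite !word_adj_rcons !(perm_mem puw').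
  have adjF r : perm_eq (unzip1 u) (unzip1 r) -> (a == v) || (b == v) ->
      word_adj r a b = false.
    move=> pr ab; apply/negP => /word_adj_mem; rewrite -!(perm_mem pr).
    by case/orP: ab => /eqP ->; rewrite (negbTE vu) ?andbF.
  case: (boolP ((a == v) || (b == v))) => ab; first by rewrite !adjF.
  by move: ab; rewrite negb_or => /andP[/negbTE -> /negbTE ->]; rewrite !andbF !orbF.
- by move: cu; rewrite -cats1 => /canonical_cat /andP[].
- by case: u u1 su {cu uu puw adj mv puw' uu' vu u0} => [|y [|z u]].
- by move: cw; rewrite -cats1 => /canonical_cat /andP[].
- move: u1; have /perm_size := puw'; rewrite !size_map => ->.
  by case: w sw {cw uw puw adj mv' puw'} => [|y [|z w]].
Qed.

End WordGraphs.

(** * Constructions of threshold graphs *)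

Section Constructions.
Variable n : nat.
Implicit Types (c : signed_perm n) (u w : seq ('I_n * bool)).

Definition letter c (i : 'I_n) : 'I_n * bool := (c.1 i, c.2 i).

Definition word_of c := [seq letter c i | i <- enum 'I_n].

Definition full_word u := perm_eq (unzip1 u) (enum 'I_n).

Lemma size_word_of c : size (word_of c) = n.
Proof. by rewrite size_map size_enum_ord. Qed.

Lemma nth_word_of c x0 (i : 'I_n) : nth x0 (word_of c) i = letter c i.
Proof. by rewrite (nth_map i) ?size_enum_ord // nth_ord_enum. Qed.

Lemma full_word_of c : full_word (word_of c).
Proof.
rewrite /full_word /unzip1 -map_comp; apply: uniq_perm; rewrite ?enum_uniq //.
  by rewrite map_inj_uniq ?enum_uniq //; exact: perm_inj.
move=> v; rewrite mem_enum; apply/mapP; exists ((c.1)^-1%g v); rewrite ?mem_enum //=.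
by rewrite permKV.
Qed.

Lemma uniq_full_word u : full_word u -> uniq (unzip1 u).
Proof. by move=> /perm_uniq ->; exact: enum_uniq. Qed.

Lemma size_full_word u : full_word u -> size u = n.
Proof. by move=> /perm_size; rewrite size_map size_enum_ord. Qed.

Lemma full_word_ofP u : full_word u -> exists c, word_of c = u.
Proof.
move=> fu; pose t := Tuple (introT eqP (size_full_word fu)).
have inj : injective (fun i => (tnth t i).1).
  move=> i j eij; apply: val_inj; apply/eqP.
  have := uniq_full_word fu => uu.
  have x0 : 'I_n * bool by exact: tnth t i.
  rewrite -(nth_uniq x0.1 _ _ uu) ?size_map ?size_full_word //;
    [|exact: ltn_ord|exact: ltn_ord].
  rewrite /unzip1 !(nth_map x0) ?size_full_word //; [|exact: ltn_ord|exact: ltn_ord].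
  by move: eij; rewrite !(tnth_nth x0) /= => ->.
exists (perm inj, [ffun i => (tnth t i).2]).
rewrite /word_of (eq_map (g := tnth t)) ?map_tnth_enum // => i.
by rewrite /letter /= permE ffunE; case: (tnth t i).
Qed.

Lemma set2_inj (a b a' b' : 'I_n) : [set a; b] = [set a'; b'] ->
  (a = a' /\ b = b') \/ (a = b' /\ b = a').
Proof.
move=> /setP e.
have := e a; have := e b; have := e a'; have := e b'; rewrite !inE !eqxx /= ?orbT.
by move=> /orP[]/eqP h1 /orP[]/eqP h2 /esym/orP[]/eqP h3 /esym/orP[]/eqP h4; subst; auto.
Qed.

Definition word_graph u : graph n :=
  [set [set ab.1; ab.2] | ab : 'I_n * 'I_n & word_adj u ab.1 ab.2].

Lemma mem_word_graph u a b : ([set a; b] \in word_graph u) = word_adj u a b.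
Proof.
apply/imsetP/idP => [[[a' b']]|adj]; last by exists (a, b); rewrite ?inE.
by rewrite inE /= => adj /set2_inj[[-> ->]|[-> ->]]; rewrite // word_adj_sym.
Qed.

Lemma word_adjP x0 u a b : word_adj u a b <->
  exists i k, [/\ i < k, k < size u, (nth x0 u k).2 &
    (a = (nth x0 u i).1 /\ b = (nth x0 u k).1) \/
    (b = (nth x0 u i).1 /\ a = (nth x0 u k).1)].
Proof.
elim: u => [|x u IH] /=; first by split => // -[i [k []]].
split.
  case/or3P => [/andP[/eqP -> bu]|/andP[/eqP -> au]|/IH[i [k [ik ku sk H]]]].
  - exists 0, (index (b, true) u).+1; rewrite /= nth_index //.
    by split; rewrite ?ltnS ?index_mem //; left.
  - exists 0, (index (a, true) u).+1; rewrite /= nth_index //.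
    by split; rewrite ?ltnS ?index_mem //; right.
  - by exists i.+1, k.+1.
case=> [[|i] [[|k] [//= ik ku sk H]]]; last first.
  by apply/or3P/Or33/IH; exists i, k.
have mk : ((nth x0 u k).1, true) \in u.
  by rewrite -sk -surjective_pairing mem_nth.
by case: H => [[-> ->]|[-> ->]]; rewrite eqxx mk ?orbT.
Qed.

Lemma graph_of_word c : graph_of c = word_graph (word_of c).
Proof.
case n0 : (n == 0).
  have none (i : 'I_n) : False by case: i => i; rewrite (eqP n0).
  by apply/setP => e; apply/imsetP/imsetP => -[[i]]; case: (none i).
have x0 : 'I_n * bool by split; [apply: (@Ordinal n 0); rewrite lt0n n0|exact: true].
apply/setP => e; apply/imsetP/imsetP => -[[i k]]; rewrite inE /=.
  move=> /andP[ik sk] ->; exists (c.1 i, c.1 k) => //; rewrite inE /=.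
  apply/(word_adjP x0); exists i, k; rewrite size_word_of !nth_word_of.
  by split => //; left.
move=> /(word_adjP x0)[i' [k' [ik' kn sk H]]] ->.
rewrite size_word_of in kn; have iN := ltn_trans ik' kn.
move: sk H; rewrite -[i']/(val (Ordinal iN)) -[k']/(val (Ordinal kn)).
rewrite !nth_word_of /= => sk H.
exists (Ordinal iN, Ordinal kn); first by rewrite inE /= ik'.
by case: H => -[-> ->] //=; rewrite setUC.
Qed.

Lemma word_graph_inj u w : word_graph u = word_graph w -> word_adj u =2 word_adj w.
Proof. by move=> e a b; rewrite -!mem_word_graph e. Qed.

Lemma eq_word_graph u w : word_adj u =2 word_adj w -> word_graph u = word_graph w.
Proof.
move=> e; apply/setP => g; apply/imsetP/imsetP => -[[a b]]; rewrite inE /= => adj ->;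
  by exists (a, b) => //; rewrite inE /= ?e // -e.
Qed.

Definition block_step (x y : 'I_n * bool) := (y.2 != x.2) || (x.1 <= y.1)%N.

Lemma canonical_sorted s0 u : canonical 0 s0 u = sorted block_step u.
Proof.
have H (x : 'I_n * bool) w : canonical x.1 x.2 w = path block_step x w.
  by elim: w x => //= y w IH x; rewrite IH.
by case: u => //= x u; rewrite leq0n orbT H.
Qed.

Lemma standard_formE c s0 : 1 < n ->
  standard_form c = canonical 0 s0 (word_of c) && std_start (word_of c).
Proof.
move=> n1; have n0 := ltnW n1.
pose i0 := Ordinal n0; pose i1 := Ordinal n1; pose x0 := letter c i0.
rewrite canonical_sorted andbC /standard_form; congr (_ && _).
  have -> : std_start (word_of c) = (c.2 i1 == c.2 i0).
    have := nth_word_of c x0 i0; have := nth_word_of c x0 i1.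
    have := size_word_of c; case: (word_of c) => [|x [|y u]] /= sz.
    - by have := n0; rewrite -{1}sz.
    - by have := n1; rewrite -{1}sz.
    by move=> -> ->.
  apply/forallP/idP => [/(_ i0)/forallP/(_ i1)/=|]; first by rewrite eq_sym.
  move=> e i; apply/forallP => k; apply/implyP => /andP[/eqP hi /eqP hk].
  rewrite (_ : i = i0); last exact: val_inj.
  by rewrite (_ : k = i1) 1?eq_sym //; exact: val_inj.
apply/forallP/(sortedP x0) => [H i|H i].
  rewrite size_word_of => i1n; pose k := Ordinal i1n; pose i' := Ordinal (ltnW i1n).
  rewrite -[i.+1]/(val k) -[i]/(val i') !nth_word_of /block_step /=.
  have /forallP/(_ k)/implyP := H i'; rewrite /= eqxx /=.
  case: eqP => [e /(_ isT) lt|e _]; first by rewrite (ltnW lt) orbT.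
  by rewrite eq_sym; move/eqP: e => ->.
apply/forallP => k; apply/implyP => /andP[/eqP ki /eqP e].
have := H i; rewrite size_word_of -ki !nth_word_of /block_step /= e eqxx.
move=> /(_ (ltn_ord k)) /= le.
(* [canonical] compares labels weakly and the standard form strictly; distinct steps have distinct
   labels. *)
rewrite ltn_neqAle le andbT; apply/eqP => /val_inj /perm_inj ik.
by move: ki; rewrite ik => /eqP; rewrite -{1}(addn0 (val k)) -addn1 eqn_add2l.
Qed.

(** * Odd anchors as sign changes *)

Section OddAnchors.
Variable c : signed_perm n.

(** The default [false] makes the first anchor odd exactly when it is dominant. *)
Let last_sign (s : seq 'I_n) : bool :=
  foldl (fun p i => if anchor c i then c.2 i else p) false s.

Lemma last_signP (s : seq 'I_n) : pairwise (fun i k : 'I_n => i < k)%N s ->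
  (forall k, k \in s -> ~~ anchor c k) /\ last_sign s = false \/
  exists q, [/\ q \in s, anchor c q, (forall k, k \in s -> anchor c k -> (k <= q)%N)
    & last_sign s = c.2 q].
Proof.
elim/last_ind: s => [|s i IH]; first by left.
rewrite pairwise_rcons => /andP[si /IH {}IH].
rewrite /last_sign foldl_rcons -/(last_sign s); case: ifP => ai.
  right; exists i; rewrite mem_rcons mem_head; split=> // k.
  by rewrite mem_rcons inE => /orP[/eqP-> //|ks _]; exact: ltnW (allP si k ks).
case: IH => [[IH ->]|[q [qs aq qmax ->]]].
  left; split=> // k; rewrite mem_rcons inE => /orP[/eqP ->|/IH //].
  by rewrite ai.
right; exists q; rewrite mem_rcons inE qs orbT; split=> // k.
by rewrite mem_rcons inE => /orP[/eqP->|/qmax //]; rewrite ai.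
Qed.

Lemma pairwise_enum_ord : pairwise (fun i k : 'I_n => i < k)%N (enum 'I_n).
Proof.
have := iota_ltn_sorted 0 n; rewrite -val_enum_ord (sorted_pairwise ltn_trans).
by rewrite pairwise_map.
Qed.

Lemma enum_ord_split (s r : seq 'I_n) (i : 'I_n) : enum 'I_n = s ++ i :: r ->
  (forall k, (k \in s) = (k < i)%N) /\ (forall k, (k \in r) = (i < k)%N).
Proof.
move=> e; have := pairwise_enum_ord; rewrite e pairwise_cat /= => /and4P[].
rewrite allrel_consr => /andP[/allP si _] _ /allP ir _.
have mem k : (k \in s) || (k == i) || (k \in r).
  by have := mem_enum 'I_n k; rewrite e mem_cat inE orbA.
split=> k; apply/idP/idP => [|ki]; [exact: si| |exact: ir|].
  have /orP[/orP[//|/eqP ki']|/ir] := mem k; first by rewrite ki' ltnn in ki.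
  by rewrite ltnNge (ltnW ki).
have /orP[/orP[/si|/eqP ki']|//] := mem k; last by rewrite ki' ltnn in ki.
by rewrite ltnNge (ltnW ki).
Qed.

Lemma odd_anchorE (s r : seq 'I_n) (i : 'I_n) : enum 'I_n = s ++ i :: r ->
  odd_anchor c i = anchor c i && (last_sign s != c.2 i).
Proof.
move=> e; have [ms mr] := enum_ord_split e.
rewrite /odd_anchor; case ai : (anchor c i) => //=.
have ss : pairwise (fun i k : 'I_n => i < k)%N s.
  by have := pairwise_enum_ord; rewrite e pairwise_cat => /and3P[].
case: (last_signP ss) => [[none ->]|[q [qs aq qmax ->]]].
  have -> : [exists p, previous_anchor c p i && (c.2 p != c.2 i)] = false.
    apply/negbTE/existsPn => p; apply/negP => /andP[/and3P[ap pi _] _].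
    by have := none p; rewrite ms pi ap => /(_ isT).
  (* The step [j] that adds label 0 is itself an anchor, and it can come neither before nor after
     [i]. *)
  rewrite orbF; suff -> : (c.1 i == 0 :> nat) by case: (c.2 i).
  have n0 : 0 < n by exact: leq_trans (ltn0Sn _) (ltn_ord i).
  pose j := ((c.1)^-1)%g (Ordinal n0).
  have cj : c.1 j = Ordinal n0 by rewrite /j permKV.
  have aj : anchor c j.
    apply/forallP => k; apply/implyP => jk; rewrite cj /= lt0n.
    apply: contraTneq jk => ck; rewrite -leqNgt; suff -> : k = j by [].
    by apply: (@perm_inj _ c.1); rewrite cj; apply: val_inj.
  case: (ltngtP i j) => ij.
  - by have := forallP ai j; rewrite ij cj /=.
  - by have := none j; rewrite ms ij aj => /(_ isT).
  - by rewrite (val_inj ij) cj.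
have qi : (q < i)%N by rewrite -ms.
have cqi : (c.1 q < c.1 i)%N by have := forallP aq i; rewrite qi.
have -> : (c.1 i == 0 :> nat) = false by apply/negbTE; rewrite -lt0n; exact: leq_trans cqi.
apply/existsP/idP => [[p /andP[/and3P[ap pi /forallP np] h]]|h].
  suff <- : p = q by [].
  apply/val_inj/eqP; rewrite eqn_leq; apply/andP; split; first by apply: qmax; rewrite ?ms.
  by rewrite leqNgt; apply/negP => pq; have := np q; rewrite pq qi aq.
exists q; rewrite h andbT /previous_anchor aq qi /=.
apply/forallP => k; apply/implyP => /andP[qk ki]; apply/negP => ak.
by have := qmax k; rewrite ms ki ak => /(_ isT isT); rewrite leqNgt qk.
Qed.

Lemma card_odd_anchor :
  #|[set i | odd_anchor c i]| = sign_changes false (word_of c).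
Proof.
have H (r s : seq 'I_n) : enum 'I_n = s ++ r ->
   sign_changes (last_sign s) (map (letter c) r) = \sum_(i <- r) odd_anchor c i.
  elim: r s => [|i r IH] s e; first by rewrite big_nil.
  have [ms mr] := enum_ord_split e.
  rewrite big_cons -(IH (rcons s i)) ?cat_rcons // (odd_anchorE e) /=.
  rewrite /last_sign foldl_rcons -/(last_sign s).
  have -> : all (fun y : 'I_n * bool => c.1 i < y.1)%N (map (letter c) r) = anchor c i.
    rewrite all_map; apply/allP/forallP => [H k|H k kr].
      by apply/implyP => ik; apply: H; rewrite mr.
    by have := H k; rewrite -mr kr.
  by case: ifP.
rewrite /word_of -[false]/(last_sign [::]) H // -sum1dep_card big_mkcond /=.
by rewrite big_enum; apply: eq_bigr => i _; case: (odd_anchor c i).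
Qed.

End OddAnchors.

(** * Standard words as normal forms of threshold graphs *)

Hypothesis n1 : 1 < n.

Lemma full_standardize u : full_word u -> full_word (standardize u).
Proof. exact: perm_trans (perm_standardize u). Qed.

Definition standard_word u := [&& full_word u, canonical 0 false u & std_start u].

Lemma standardizeP u : full_word u -> standard_word (standardize u).
Proof.
move=> fu; rewrite /standard_word full_standardize // canonical_standardize.
by rewrite std_start_standardize // size_full_word.
Qed.

Lemma standard_word_graph_inj u w : standard_word u -> standard_word w ->
  word_graph u = word_graph w -> u = w.
Proof.
move=> /and3P[fu cu su] /and3P[fw cw sw] /word_graph_inj adj.
apply: (@standard_word_inj _ u w false) => //; first by rewrite size_full_word.
  exact: uniq_full_word.
by apply: perm_trans fu _; rewrite perm_sym.
Qed.

Lemma word_graph_standardize u : word_graph (standardize u) = word_graph u.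
Proof. by apply: eq_word_graph; exact: word_adj_standardize. Qed.

Definition starts_at0 u := if u is x :: _ then x.1 == 0 :> nat else false.

(** Labels increase within a block of the unique standard word, so in the first block 0 can only
    come first. *)
Lemma in_first_blockE c (v : 'I_n) : v = 0 :> nat ->
  in_first_block (graph_of c) v = starts_at0 (standardize (word_of c)).
Proof.
move=> v0; have stdw := standardizeP (full_word_of c).
pose i0 := Ordinal (ltnW n1).
have start c' : starts_at0 (word_of c') = (c'.1 i0 == 0 :> nat).
  have := nth_word_of c' (letter c' i0) i0; have := size_word_of c'.
  by case: (word_of c') => [|x w] /= sz; [have := n1; rewrite -{1}sz|move=> ->].
apply/existsP/idP => [[c' /and3P[sf /eqP gc /existsP[i /andP[/eqP ci /forallP same]]]]|st].
  have e : word_of c' = standardize (word_of c).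
    apply: standard_word_graph_inj => //.
      by rewrite /standard_word full_word_of -standard_formE.
    by rewrite word_graph_standardize -!graph_of_word.
  rewrite -e start; suff -> : i0 = i by rewrite ci v0.
  apply: val_inj => /=; case i1 : (val i) => [//|k].
  have ik : nat_of_ord i = k.+1 := i1.
  have kn : k < n by have := ltn_ord i; rewrite ik => /ltnW.
  have := same (Ordinal kn); rewrite /= ik leqnSn /= => ss.
  have /andP[_ /forallP/(_ (Ordinal kn))/forallP/(_ i)] := sf.
  by rewrite /= ik eqxx ss /= ci v0.
have [c' ec'] := full_word_ofP (full_standardize (full_word_of c)).
exists c'; move: stdw st; rewrite -ec' => /and3P[_ cw sw] st.
rewrite (standard_formE c' false) // cw sw /= !graph_of_word ec'.
rewrite word_graph_standardize eqxx /=.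
apply/existsP; exists i0; apply/andP; split.
  by move: st; rewrite start -v0 => /eqP h; apply/eqP/val_inj.
apply/forallP => k; apply/implyP; rewrite leqn0 => /eqP k0.
by rewrite (_ : k = i0) //; exact: val_inj.
Qed.

Lemma follows_conventionE c : follows_convention c =
  starts_at0 (standardize (word_of c)) ==>
  starts_at0 (word_of c) && start_sign (word_of c).
Proof.
pose i0 := Ordinal (ltnW n1).
have start : starts_at0 (word_of c) && start_sign (word_of c)
    = (c.1 i0 == 0 :> nat) && c.2 i0.
  have := nth_word_of c (letter c i0) i0; have := size_word_of c.
  by case: (word_of c) => [|x w] /= sz; [have := n1; rewrite -{1}sz|move=> ->].
rewrite start; apply/forallP/implyP => [H st|H v].
  have := H i0; rewrite eqxx in_first_blockE // st /=.
  move=> /existsP[i /and3P[/eqP i00 /eqP ci si]].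
  have <- : i = i0 by exact: val_inj.
  by rewrite ci si.
apply/implyP => /andP[/eqP v0]; rewrite in_first_blockE // => /H /andP[/eqP ci si].
apply/existsP; exists i0; rewrite /= si andbT.
by apply/eqP/val_inj; rewrite /= ci v0.
Qed.

Lemma insert_min (x : 'I_n * bool) u : x.1 = 0 :> nat -> insert x u = x :: u.
Proof. by case: u => //= y u ->; rewrite ltn0 andbF. Qed.

Lemma standardize_head (x : 'I_n * bool) u : x.1 = 0 :> nat ->
  exists s, standardize (x :: u) = (x.1, s) :: word_sort u.
Proof.
move=> x0; case: u => [|y u].
  by exists x.2; rewrite /standardize /= -surjective_pairing.
by exists y.2; rewrite /standardize /= insert_min.
Qed.

Lemma mem_full_word u v : full_word u -> v \in unzip1 u.
Proof. by move=> /perm_mem ->; rewrite mem_enum. Qed.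

(** Sorting preserves [sign_changes], and retyping matters only when the first letter is an anchor,
    that is, has label 0. The convention then provides the sign + that [odd_stat] assumes. *)
Lemma sign_changes_convention c : follows_convention c ->
  sign_changes false (word_of c) = odd_stat (standardize (word_of c)).
Proof.
rewrite follows_conventionE; have := full_word_of c; have := size_word_of c.
case: (word_of c) => [|x u] /= sz fu; first by have := n1; rewrite -{1}sz.
have [x0|x0] := eqVneq (val x.1) 0.
  have [s ->] := standardize_head u x0; rewrite /= x0 eqxx /= => xs.
  rewrite xs /= sign_changes_sort.
  have -> // : all (fun y : 'I_n * bool => 0 < y.1)%N u.
  have := uniq_full_word fu => /= /andP[xu _].
  apply/allP => y yu; rewrite lt0n; apply: contraNneq xu => y0.
  by rewrite (_ : x.1 = y.1) ?(map_f fst yu) //; apply: val_inj; rewrite x0.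
rewrite /= implybF => st.
have na : all (fun y : 'I_n * bool => x.1 < y.1)%N u = false.
  apply/negP => /allP al.
  have := mem_full_word (Ordinal (ltnW n1)) fu; rewrite inE => /orP[/eqP h|].
    by rewrite -h in x0.
  by move=> /mapP[y yu h]; have := al y yu; rewrite -h.
rewrite na -[RHS](_ : sign_changes false (standardize (x :: u)) = _); last first.
  by case: (standardize _) st => //= y w; case: eqP.
rewrite sign_changes_sort; case: u na {sz fu st} => [|y u] //= na.
by rewrite na.
Qed.

(** If the standard word starts with 0, its first sign is set to +, which does not affect the graph;
    otherwise the standard word itself serves. *)
Lemma convention_exists c :
  exists2 c', graph_of c' = graph_of c & follows_convention c'.
Proof.
have fs := full_standardize (full_word_of c).
have [st|nst] := boolP (starts_at0 (standardize (word_of c))); last first.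
  have [c' ec'] := full_word_ofP fs; exists c'.
    by rewrite !graph_of_word ec' word_graph_standardize.
  rewrite follows_conventionE; apply/implyP.
  have -> : standardize (word_of c') = standardize (word_of c).
    apply: standard_word_graph_inj; rewrite ?standardizeP ?full_word_of //.
    by rewrite !word_graph_standardize ec' word_graph_standardize.
  by rewrite (negbTE nst).
case E : (standardize (word_of c)) st => [//|x u] /eqP x0.
have fu : full_word ((x.1, true) :: u) by rewrite E in fs.
have [c' ec'] := full_word_ofP fu; exists c'.
  rewrite !graph_of_word ec' -(word_graph_standardize (word_of c)) E.
  exact: eq_word_graph.
by rewrite follows_conventionE ec' /= x0 implybT.
Qed.

Lemma odd_anchors_graph c : odd_anchors (graph_of c) = odd_stat (standardize (word_of c)).
Proof.
rewrite /odd_anchors; case: pickP => [c' /andP[/eqP gc conv]|none].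
  rewrite card_odd_anchor sign_changes_convention //; congr odd_stat.
  apply: standard_word_graph_inj; rewrite ?standardizeP ?full_word_of //.
  by rewrite !word_graph_standardize -!graph_of_word.
by have [c' gc conv] := convention_exists c; have := none c'; rewrite gc eqxx conv.
Qed.

Definition standard_words := [seq u <- canonical_words n (enum 'I_n) 0 false | std_start u].

Lemma mem_standard_words u : (u \in standard_words) = standard_word u.
Proof.
by rewrite mem_filter mem_canonical_words ?size_enum_ord // andbC -andbA.
Qed.

(** Each threshold graph comes from exactly one standard word, on which [odd_stat] reads off its
    number of odd anchors. *)
Lemma card_threshold_odd j :
  #|[set G : graph n | is_threshold G && (odd_anchors G == j)]|
  = count (fun u => odd_stat u == j) standard_words.
Proof.
pose L := [seq u <- standard_words | odd_stat u == j].
have uL : uniq (map word_graph L).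
  rewrite map_inj_in_uniq ?filter_uniq ?uniq_canonical_words ?enum_uniq //.
  move=> u w; rewrite [u \in L]mem_filter [w \in L]mem_filter !mem_standard_words.
  by move=> /andP[_ su] /andP[_ sw]; exact: standard_word_graph_inj.
rewrite -size_filter -(size_map word_graph) -(card_uniqP uL); apply: eq_card => G.
rewrite inE; apply/andP/mapP => [[/existsP[c /eqP <-] oj]|[u uL' ->]].
  exists (standardize (word_of c)); last by rewrite word_graph_standardize graph_of_word.
  by rewrite mem_filter mem_standard_words -odd_anchors_graph oj standardizeP ?full_word_of.
move: uL'; rewrite mem_filter mem_standard_words => /andP[oj su].
have [c ec] := full_word_ofP (proj1 (andP su)).
have e : standardize (word_of c) = u.
  apply: standard_word_graph_inj; rewrite ?standardizeP ?full_word_of //.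
  by rewrite word_graph_standardize ec.
split; first by apply/existsP; exists c; rewrite graph_of_word ec.
by rewrite -ec -graph_of_word odd_anchors_graph e.
Qed.

End Constructions.

(** * Comparison of polynomials at odd integers *)

Section Comparison.
Local Open Scope ring_scope.

Lemma poly_eq_at_odd (p q : {poly int}) :
  (forall m : nat, p.[(2 * m + 1)%:Z] = q.[(2 * m + 1)%:Z]) -> p = q.
Proof.
move=> pq; apply/eqP; rewrite -subr_eq0; apply/negPn/negP => nz.
pose rs := [seq (2 * m + 1)%:Z | m <- iota 0 (size (p - q))].
suff: (size rs < size (p - q)%R)%N by rewrite size_map size_iota ltnn.
apply: max_poly_roots nz _ _.
  by apply/allP => _ /mapP[m _ ->]; rewrite rootE hornerD hornerN pq subrr.
by rewrite map_inj_uniq ?iota_uniq // => a b []; lia.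
Qed.

(** This is [(-1)^n P(-X)], where [P] is the generating polynomial of [odd_stat] on standard
    words. *)
Definition signed_odd_poly n : {poly int} :=
  \sum_(u <- standard_words n) (-1) ^+ (n + odd_stat u) *: 'X^(odd_stat u).

Lemma coef_signed_odd_poly n j : (signed_odd_poly n)`_j =
  (-1) ^+ (n + j) * (count (fun u => odd_stat u == j) (standard_words n))%:Z.
Proof.
rewrite /signed_odd_poly coef_sum.
elim: (standard_words n) => [|u s IH]; first by rewrite big_nil mulr0.
rewrite big_cons IH coefZ coefXn /= eq_sym PoszD mulrDr; congr (_ + _).
by case: eqP => [->|_]; rewrite ?mulr0 ?mulr1.
Qed.

Lemma horner_signed_odd_poly n m : (1 < n)%N ->
  (signed_odd_poly n).[(2 * m + 1)%:Z]
  = colorings n 0 m + n%:Z * colorings n.-1 0 m.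
Proof.
case: n => [|[|n]] // _; rewrite /signed_odd_poly horner_sum.
pose t := - (2 * m + 1)%:Z.
transitivity ((-1) ^+ n.+2 * \sum_(u <- standard_words n.+2) t ^+ odd_stat u).
  rewrite big_distrr /=; apply: eq_bigr => u _.
  by rewrite hornerZ hornerXn /t exprD -mulrA -exprMn mulN1r.
rewrite big_filter sum_odd_stat ?size_enum_ord ?enum_uniq //; last first.
  by exists ord0; rewrite ?mem_enum.
rewrite -!word_sum_colorings -/t /= exprS; ring.
Qed.

End Comparison.

Theorem theorem5p11 (R : realType) (n j : nat) (hn : (2 <= n)%N) (hj : (j <= n)%N) :
  `|((arr_char_poly (threshold_arrangement R n))`_j)%R|%N
  = #|[set G : graph n | is_threshold G && (odd_anchors G == j)]|.
Proof.
rewrite card_threshold_odd //.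
have -> : arr_char_poly (threshold_arrangement R n) = signed_odd_poly n.
  apply: poly_eq_at_odd => m.
  by rewrite arr_char_poly_threshold horner_signed_odd_poly.
(* The coefficient is the count up to the sign [(-1)^(n + j)], which the absolute value removes. *)
by rewrite coef_signed_odd_poly abszM abszX exp1n mul1n.
Qed.
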